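(* For any $n$, there is an algorithm recognizing homotopy of closed polygonal lines in the plane minus $n$ points.
   Context: An oriented cyclic sequence is an ordered set up to a cyclic shift. A closed (oriented) polygonal line in the plane is an oriented cyclic sequence $A_1\ldots A_m$ of points in the plane (its vertices; the points need not be distinct); it is said to be in a subset $N$ of the plane if the union of the segments $A_1A_2,\ldots,A_{m-1}A_m,A_mA_1$ is contained in $N$. An elementary cancellation in $N$ of a closed polygonal line in $N$ is the removal of a vertex $B$ such that for the vertices $A,C$ (that need not be distinct) adjacent to $B$ the convex hull of $A,B,C$ is contained in $N$. A (piecewise linear) homotopy in $N$ is a finite sequence of closed polygonal lines in which for any two consecutive polygonal lines one is obtained from the other by an elementary cancellation in $N$. Two closed polygonal lines are (piecewise linearly) homotopic in $N$ if there exists a homotopy in $N$ whose first and last polygonal lines coincide with the given ones. In the claim, $N$ is the plane minus $n$ points, and ''recognizing homotopy'' means deciding whether two given closed polygonal lines in $N$ are homotopic in $N$. *)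

(* Defs.v *)
From mathcomp Require Import all_boot all_order all_algebra.
From mathcomp Require Import classical_sets reals normedtype.

Set Implicit Arguments.
Unset Strict Implicit.
Unset Printing Implicit Defensive.

Import Order.TTheory GRing.Theory Num.Theory numFieldNormedType.Exports.
Local Open Scope classical_set_scope.
Local Open Scope ring_scope.

Notation plane R := (R * R)%type (only parsing).

Definition segment (R : realType) (A B : plane R) : set (plane R) :=
  [set X | exists a b : R, [/\ 0 <= a, 0 <= b, a + b = 1 &
    X = a *: A + b *: B]].

(* The convex hull of three points, which may be collinear or coincide. *)
Definition triangle (R : realType) (A B C : plane R) : set (plane R) :=
  [set X | exists a b c : R, [/\ 0 <= a, 0 <= b, 0 <= c, a + b + c = 1 &
    X = a *: A + b *: B + c *: C]].

(* A cyclic sequence is represented by any of its linear orderings; two lists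
   are the same cyclic sequence when they differ by a rotation. *)
Definition same_cyclic (T : Type) (s t : seq T) : Prop :=
  exists k : nat, t = rot k s.

(* [zip l (rot 1 l)] lists the pairs (A_1, A_2), ..., (A_m, A_1). *)
Definition closed_line_in (R : realType) (N : set (plane R))
    (l : seq (plane R)) : Prop :=
  l <> [::] /\
  forall A B : plane R, (A, B) \in zip l (rot 1 l) -> segment A B `<=` N.

(* [l'] is obtained from [l] by removing the vertex [B], whose neighbours in
   the cyclic sequence B, C, ..., A are C and A = last C r; these are the same
   vertex when r is empty.  The last vertex of a line is never removed. *)
Definition elementary_cancellation (R : realType) (N : set (plane R))
    (l l' : seq (plane R)) : Prop :=
  exists (B C : plane R) (r : seq (plane R)),
    [/\ same_cyclic l (B :: C :: r),
        triangle (last C r) B C `<=` N &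
        same_cyclic l' (C :: r)].

Definition homotopic (R : realType) (N : set (plane R))
    (l l' : seq (plane R)) : Prop :=
  exists (k : nat) (L : nat -> seq (plane R)),
    [/\ same_cyclic l (L 0%N),
        same_cyclic l' (L k),
        forall i, (i <= k)%N -> closed_line_in N (L i) &
        forall i, (i < k)%N ->
          elementary_cancellation N (L i) (L i.+1) \/
          elementary_cancellation N (L i.+1) (L i)].

Definition plane_minus (R : realType) (p : seq (plane R)) : set (plane R) :=
  [set X | X \notin p].

(* Algorithms on points with real coordinates are programs of a real RAM
   (equivalently, machines over R in the sense of Blum, Shub and Smale),
   written as structured programs.  The memory consists of unbounded arrays of
   natural numbers and of real numbers; a program is a finite syntax tree, so
   it uses finitely many arrays.  Reals can only be combined by the field
   operations and compared; there are no real constants other than naturals,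
   and no conversion from reals to naturals.  In particular, a program run on
   rational inputs manipulates rational numbers only. *)

Inductive nexp : Type :=
| Nconst of nat
| Nget of nat & nexp
| Nadd of nexp & nexp
| Nsub of nexp & nexp.

Inductive rexp : Type :=
| Rconst of nat
| Rget of nat & nexp
| Radd of rexp & rexp
| Ropp of rexp
| Rmul of rexp & rexp
| Rinv of rexp.

Inductive bexp : Type :=
| Nle of nexp & nexp
| Rle of rexp & rexp
| Bnot of bexp
| Band of bexp & bexp.

Inductive program : Type :=
| Skip
| Nset of nat & nexp & nexp
| Rset of nat & nexp & rexp
| Seq of program & program
| If of bexp & program & program
| While of bexp & program.

Record state (R : realType) : Type := State {
  nmem : nat -> nat -> nat;
  rmem : nat -> nat -> R
}.

Definition update (T : Type) (m : nat -> nat -> T) (a i : nat) (v : T) :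
    nat -> nat -> T :=
  fun a' i' => if (a' == a) && (i' == i) then v else m a' i'.

Fixpoint neval (R : realType) (s : state R) (e : nexp) : nat :=
  match e with
  | Nconst k => k
  | Nget a e1 => nmem s a (neval s e1)
  | Nadd e1 e2 => (neval s e1 + neval s e2)%N
  | Nsub e1 e2 => (neval s e1 - neval s e2)%N
  end.

Fixpoint reval (R : realType) (s : state R) (e : rexp) : R :=
  match e with
  | Rconst k => k%:R
  | Rget a e1 => rmem s a (neval s e1)
  | Radd e1 e2 => reval s e1 + reval s e2
  | Ropp e1 => - reval s e1
  | Rmul e1 e2 => reval s e1 * reval s e2
  | Rinv e1 => (reval s e1)^-1
  end.

Fixpoint beval (R : realType) (s : state R) (e : bexp) : bool :=
  match e with
  | Nle e1 e2 => (neval s e1 <= neval s e2)%N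
  | Rle e1 e2 => reval s e1 <= reval s e2
  | Bnot e1 => ~~ beval s e1
  | Band e1 e2 => beval s e1 && beval s e2
  end.

(* [exec P s s'] : started in [s], the program [P] halts in [s']. *)
Inductive exec (R : realType) : program -> state R -> state R -> Prop :=
| ExecSkip s : exec Skip s s
| ExecNset a e v s :
    exec (Nset a e v) s
      (State (update (nmem s) a (neval s e) (neval s v)) (rmem s))
| ExecRset a e v s :
    exec (Rset a e v) s
      (State (nmem s) (update (rmem s) a (neval s e) (reval s v)))
| ExecSeq P Q s1 s2 s3 :
    exec P s1 s2 -> exec Q s2 s3 -> exec (Seq P Q) s1 s3
| ExecIfTrue b P Q s s' :
    beval s b -> exec P s s' -> exec (If b P Q) s s'
| ExecIfFalse b P Q s s' :
    ~~ beval s b -> exec Q s s' -> exec (If b P Q) s s'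
| ExecWhileTrue b P s1 s2 s3 :
    beval s1 b -> exec P s1 s2 -> exec (While b P) s2 s3 ->
    exec (While b P) s1 s3
| ExecWhileFalse b P s :
    ~~ beval s b -> exec (While b P) s s.

Lemma exec_deterministic (R : realType) (P : program) (s s1 s2 : state R) :
  exec P s s1 -> exec P s s2 -> s1 = s2.
Proof.
move=> H; elim: H s2 => {P s s1}
  [s|a e v s|a e v s|P Q s t u _ IH1 _ IH2|b P Q s t hb _ IH|b P Q s t hb _ IH
  |b P s t u hb _ IH1 _ IH2|b P s hb] s2 H; inversion H; subst => //.
- by apply: IH2; match goal with h : exec P _ _ |- _ => rewrite (IH1 _ h) end.
- exact: IH.
- by match goal with h : is_true (~~ _) |- _ => rewrite hb in h end.
- by match goal with h : is_true (beval _ _) |- _ => rewrite h in hb end.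
- exact: IH.
- by apply: IH2; match goal with h : exec P _ _ |- _ => rewrite (IH1 _ h) end.
- by match goal with h : is_true (~~ _) |- _ => rewrite hb in h end.
- by match goal with h : is_true (beval _ _) |- _ => rewrite h in hb end.
Qed.

(* The abscissas and ordinates of the points of p, l, l' fill the real arrays
   0-1, 2-3, 4-5; the three lengths are in the natural array 0.  All other
   cells contain 0. *)
Definition input (R : realType) (p l l' : seq (plane R)) : state R :=
  State
    (fun a i =>
       if a == 0%N then nth 0%N [:: size p; size l; size l'] i else 0%N)
    (fun a i =>
       match a with
       | 0 => (nth (0, 0) p i).1
       | 1 => (nth (0, 0) p i).2
       | 2 => (nth (0, 0) l i).1
       | 3 => (nth (0, 0) l i).2
       | 4 => (nth (0, 0) l' i).1
       | 5 => (nth (0, 0) l' i).2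
       | _ => 0
       end).

(* The answer is read in cell 0 of the natural array 0: nonzero means yes. *)
Definition answers (R : realType) (P : program) (s : state R) (Q : Prop) :
    Prop :=
  exists s' : state R, exec P s s' /\ (nmem s' 0 0 <> 0%N <-> Q).

Definition recognizes_homotopy (R : realType) (n : nat) (P : program) : Prop :=
  forall p : n.-tuple (plane R), uniq p ->
  forall l l' : seq (plane R),
    closed_line_in (plane_minus p) l ->
    closed_line_in (plane_minus p) l' ->
    answers P (input p l l') (homotopic (plane_minus p) l l').

(* Main.v *)
Require Import Defs.
From mathcomp Require Import all_boot all_order all_algebra reals.
From mathcomp Require Import boolp classical_sets normedtype.
From mathcomp Require Import lra ring zify.

Set Implicit Arguments.
Unset Strict Implicit.
Unset Printing Implicit Defensive.

Import Order.TTheory GRing.Theory Num.Theory numFieldNormedType.Exports.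
Local Open Scope ring_scope.

(* Record, in order and with signs, the crossings of a closed line with the
   upward rays issuing from the punctures.  Across a triangle without punctures
   this word changes only by free cancellations, so a homotopy preserves its
   conjugacy class in the free group on the punctures.  Conversely, push every
   vertex vertically to a base line below all punctures: an edge crossing no
   ray is pushed down with it, an edge crossing one ray becomes a standard loop
   around that puncture, so a line is homotopic to a product of standard loops
   which depends on its word only, and homotopies realize conjugation of words.
   Ties between abscissas are broken by the lexicographic order, that is, by an
   infinitesimal shear.  Conjugacy is decided by comparing cyclic reductions up
   to rotation; these are unique by the diamond lemma. *)


(** * Cyclic words and conjugacy in free groups *)

(** The difficulty is degenerate position: punctures may share an abscissa, and vertices may lie
    straight above a puncture. A program could not easily pick a good direction, so the word is read
    off lexicographic comparisons and signs of areas, and these are defined for every input. A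
    genuine shear occurs only in the proof of the converse. For finitely many points a small enough
    shear turns the lexicographic order into the order of abscissas. It also preserves areas, so the
    words stay the same while the position becomes generic.

    Deformations are carried out on paths with fixed ends, because there one edge can be replaced
    without regard to the others. A closed line is turned into such a path by inserting a detour to
    a base point.

    The number of punctures is known when the program is written, so everything that ranges over
    punctures or their orders is unrolled into the program text. Only the passes over vertices,
    letters and rotations are loops. *)

Section CyclicSequences.
Variable T : Type.
Implicit Types s t u : seq T.

Lemma same_cyclic_refl s : same_cyclic s s.
Proof. by exists 0%N; rewrite rot0. Qed.

Lemma same_cyclic_sym s t : same_cyclic s t -> same_cyclic t s.
Proof. by move=> [k ->]; exists (size (rot k s) - k)%N; rewrite -/(rotr _ _) rotK. Qed.

Lemma same_cyclic_cat s t : same_cyclic (s ++ t) (t ++ s).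
Proof. by exists (size s); rewrite rot_size_cat. Qed.

Lemma same_cyclicP s t :
  same_cyclic s t <-> exists u v, s = u ++ v /\ t = v ++ u.
Proof.
split=> [[k ->]|[u [v [-> ->]]]]; last exact: same_cyclic_cat.
by exists (take k s), (drop k s); rewrite cat_take_drop.
Qed.

Lemma same_cyclic_bounded s t :
  same_cyclic s t <-> exists2 k, (k <= size s)%N & t = rot k s.
Proof.
split=> [[k ->]|[k _ ->]]; last by exists k.
case: (leqP k (size s)) => [le_ks|lt_sk]; first by exists k.
by exists (size s); rewrite // rot_size rot_oversize // ltnW.
Qed.

Lemma same_cyclic_trans t s u :
  same_cyclic s t -> same_cyclic t u -> same_cyclic s u.
Proof.
move=> /same_cyclic_bounded[k hk ->] /same_cyclic_bounded[m].
rewrite size_rot => hm ->.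
by rewrite rot_add_mod //; eexists.
Qed.

Lemma same_cyclic_size s t : same_cyclic s t -> size s = size t.
Proof. by case=> k ->; rewrite size_rot. Qed.

End CyclicSequences.

Lemma same_cyclic_map (T T' : Type) (f : T -> T') (s t : seq T) :
  same_cyclic s t -> same_cyclic (map f s) (map f t).
Proof. by move=> [k ->]; exists k; rewrite map_rot. Qed.

Section CyclicWords.
Variables (T : eqType) (inv : T -> T).
Hypothesis invK : involutive inv.
Implicit Types (x y : T) (a b c d t u v w : seq T).

(* Conjugacy in the free group: cyclic words up to insertion and deletion of
   adjacent mutually inverse letters. *)
Inductive conjugate : seq T -> seq T -> Prop :=
| conjugate_refl w : conjugate w w
| conjugate_sym u v : conjugate u v -> conjugate v u
| conjugate_trans v u w : conjugate u v -> conjugate v w -> conjugate u w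
| conjugate_cat u v : conjugate (u ++ v) (v ++ u)
| conjugate_cancel x w : conjugate [:: x, inv x & w] w.

Lemma conjugate_same_cyclic u v : same_cyclic u v -> conjugate u v.
Proof. by case/same_cyclicP => [a [b [-> ->]]]; exact: conjugate_cat. Qed.

(** Equality in the free group, expressed by conjugacy alone: with [w] the inverse of [v] it says
    that u v^-1 is conjugate to the empty word, hence trivial. *)
Definition free_eq u v := forall w, conjugate (u ++ w) (v ++ w).

Lemma free_eq_refl u : free_eq u u.
Proof. by move=> w; exact: conjugate_refl. Qed.

Lemma free_eq_sym u v : free_eq u v -> free_eq v u.
Proof. by move=> e w; exact: conjugate_sym. Qed.

Lemma free_eq_trans v u w : free_eq u v -> free_eq v w -> free_eq u w.
Proof. by move=> e1 e2 t; apply: conjugate_trans (e1 t) (e2 t). Qed.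

Lemma free_eq_cat u u' v v' :
  free_eq u u' -> free_eq v v' -> free_eq (u ++ v) (u' ++ v').
Proof.
move=> eu ev w; rewrite -!catA; apply: conjugate_trans (eu _) _.
apply: conjugate_trans (conjugate_cat _ _) _.
apply: conjugate_trans (conjugate_cat _ _).
by rewrite -!catA; exact: ev.
Qed.

Lemma free_eq_conjugate u v : free_eq u v -> conjugate u v.
Proof. by move=> /(_ [::]); rewrite !cats0. Qed.

Definition inv_word w := rev (map inv w).

Lemma inv_word_cat u v : inv_word (u ++ v) = inv_word v ++ inv_word u.
Proof. by rewrite /inv_word map_cat rev_cat. Qed.

Lemma inv_wordK : involutive inv_word.
Proof. by move=> w; rewrite /inv_word map_rev revK mapK. Qed.

Lemma cat_inv_word w : free_eq (w ++ inv_word w) [::].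
Proof.
elim/last_ind: w => [|w x IHw]; first exact: free_eq_refl.
rewrite -cats1 inv_word_cat catA -(catA w) -[_ ++ inv_word w]catA.
apply: free_eq_trans (IHw); apply: free_eq_cat; first exact: free_eq_refl.
rewrite -[X in free_eq _ X]cat0s; apply: free_eq_cat; last exact: free_eq_refl.
by move=> v; exact: conjugate_cancel.
Qed.

Lemma inv_word_cat0 w : free_eq (inv_word w ++ w) [::].
Proof. by rewrite -{2}[w]inv_wordK; exact: cat_inv_word. Qed.

Lemma free_eq_moveR u v w : free_eq u (v ++ inv_word w) -> free_eq (u ++ w) v.
Proof.
move=> h; apply: free_eq_trans (free_eq_cat h (free_eq_refl w)) _.
rewrite -catA -[X in free_eq _ X]cats0.
by apply: free_eq_cat (free_eq_refl _) _; exact: inv_word_cat0.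
Qed.

Lemma free_eq_moveL u v w : free_eq u (inv_word v ++ w) -> free_eq (v ++ u) w.
Proof.
move=> h; apply: free_eq_trans (free_eq_cat (free_eq_refl v) h) _.
rewrite catA -[X in free_eq _ X]cat0s.
by apply: free_eq_cat _ (free_eq_refl _); exact: cat_inv_word.
Qed.

Definition cyclic_cancel u v :=
  exists x w, same_cyclic u [:: x, inv x & w] /\ same_cyclic v w.

Lemma cyclic_cancel_size u v : cyclic_cancel u v -> size u = (size v).+2.
Proof. by move=> [x [w [/same_cyclic_size-> /same_cyclic_size->]]]. Qed.

(** Two cancelling pairs coincide, share one letter, or are disjoint. Removing either pair from x
    x^-1 x leaves x, so an overlap gives the same cyclic word. Disjoint pairs can be removed in
    either order. *)
Lemma cyclic_cancel_diamond a b c :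
  cyclic_cancel a b -> cyclic_cancel a c ->
  same_cyclic b c \/ exists2 d, cyclic_cancel b d & cyclic_cancel c d.
Proof.
move=> [x [t [hat hbt]]] [y [u [hau hcu]]].
have: same_cyclic [:: x, inv x & t] [:: y, inv y & u].
  exact: same_cyclic_trans (same_cyclic_sym hat) hau.
have merge : same_cyclic t u -> same_cyclic b c.
  move=> tu; apply: same_cyclic_trans hbt _.
  by apply: same_cyclic_trans tu _; exact: same_cyclic_sym.
(* The cut of the rotation locates the second pair in the first word. It starts at [x], at [inv x],
   or inside [t]; in the last case it may wrap around from the final letter to [x]. *)
case/same_cyclicP => [[|x1 [|x2 t1]]] [t2 [/= e1 e2]].
- by left; apply: merge; move: e2; rewrite cats0 -e1 => -[_ _ ->];
    exact: same_cyclic_refl.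
- move: e1 e2 => [-> <-] /= [->]; rewrite invK => e2; left; apply: merge.
  case: t e2 {hbt hat} => [|z t] /=; first by move=> [->]; exact: same_cyclic_refl.
  move=> [<- ->]; rewrite cats1.
  by rewrite -cats1 -cat1s; exact: same_cyclic_cat.
- move: e1 e2 => [<- <- et]; case: t2 et => [|z [|z' t2]] et /=.
  + move=> e2; left; apply: merge; case: e2 => _ _ ->.
    by rewrite et cats0; exact: same_cyclic_refl.
  + move=> e2; left; apply: merge; case: e2 => -> ez ->.
    have -> : inv x :: t1 = [:: z] ++ t1 by rewrite -ez invK.
    by rewrite et; exact: same_cyclic_cat.
  + move=> [ez ez' eu]; right; exists (t1 ++ t2).
      exists z, (t2 ++ t1); split; last exact: same_cyclic_cat.
      apply: same_cyclic_trans hbt _; rewrite et -ez' ez.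
      exact: same_cyclic_cat.
    exists x, (t1 ++ t2); split; last exact: same_cyclic_refl.
    apply: same_cyclic_trans hcu _; rewrite eu.
    exact: same_cyclic_cat.
Qed.

Lemma cyclic_cancel_rot a b c :
  same_cyclic a b -> cyclic_cancel b c -> cyclic_cancel a c.
Proof.
move=> ab [x [w [bw cw]]]; exists x, w; split => //.
exact: same_cyclic_trans ab bw.
Qed.

Definition noninverse : rel T := fun x y => y != inv x.

Lemma cyclic_cancel_irreducible a b :
  cycle noninverse a -> ~ cyclic_cancel a b.
Proof.
move=> ha [x [w [[k ek] _]]].
by move: ha; rewrite -(rot_cycle k) -ek /= /noninverse eqxx.
Qed.

Hypothesis inv_neq : forall x, inv x != x.

Lemma not_path_noninverse x p :
  ~~ path noninverse x p -> exists u y v, x :: p = u ++ [:: y, inv y & v].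
Proof.
elim: p x => //= y p IHp x; rewrite negb_and negbK => /orP[/eqP->|].
  by exists [::], x, p.
by move=> /IHp[u [z [v ->]]]; exists (x :: u), z, v.
Qed.

Lemma irreducible_or_cancel a :
  cycle noninverse a \/ exists b, cyclic_cancel a b.
Proof.
case: (boolP (cycle noninverse a)) => [|na]; [by left | right].
case: a na => [|x p] //=; rewrite rcons_path negb_and negbK => /orP[|/eqP ex].
  move=> /not_path_noninverse[u [y [v ->]]]; exists (v ++ u), y, (v ++ u).
  by split; [exact: same_cyclic_cat | exact: same_cyclic_refl].
(* For a one-letter word [cycle] compares the letter with itself, and [inv_neq] excludes a
   cancellation. *)
case/lastP: p ex => [/= ex|p y]; first by have := inv_neq x; rewrite -ex eqxx.
rewrite last_rcons => ->; exists p, y, p; split; last exact: same_cyclic_refl.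
by rewrite -cats1 -cat_cons; exact: same_cyclic_cat.
Qed.

Inductive reduces_to : seq T -> seq T -> Prop :=
| reduces_to_irreducible a b :
    same_cyclic a b -> cycle noninverse b -> reduces_to a b
| reduces_to_cancel a b c :
    cyclic_cancel a b -> reduces_to b c -> reduces_to a c.

Lemma reduces_to_rot a b c :
  same_cyclic a b -> reduces_to b c -> reduces_to a c.
Proof.
move=> ab bc; case: bc ab => {b c} [b c bc hc|b c d bc cd] ab.
  by apply: reduces_to_irreducible hc; exact: same_cyclic_trans ab bc.
by apply: reduces_to_cancel cd; exact: cyclic_cancel_rot ab bc.
Qed.

Lemma reduces_to_exists a : exists b, reduces_to a b.
Proof.
have [n] := ubnP (size a); elim: n a => // n IHn a /ltnSE le_an.
have [ha|[b ab]] := irreducible_or_cancel a.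
  by exists a; apply: reduces_to_irreducible => //; exact: same_cyclic_refl.
have [|c bc] := IHn b; last by exists c; exact: reduces_to_cancel ab bc.
by rewrite (leq_trans _ le_an) // (cyclic_cancel_size ab).
Qed.

Lemma reduces_to_unique a b c :
  reduces_to a b -> reduces_to a c -> same_cyclic b c.
Proof.
have irr u v : same_cyclic u v -> cycle noninverse v -> forall w,
    ~ cyclic_cancel u w.
  move=> /same_cyclic_sym vu hv w uw.
  exact: cyclic_cancel_irreducible hv (cyclic_cancel_rot vu uw).
have [n] := ubnP (size a); elim: n a b c => // n IHn a b c /ltnSE le_an.
move=> ab; case: ab le_an => {a b} [a b ab hb|a a1 b aa1 a1b] le_an ac.
  case: ac ab => {a le_an c} [a c ac hc|a a2 c aa2 _] ab; last first.
    by case: (irr _ _ ab hb _ aa2).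
  exact: same_cyclic_trans (same_cyclic_sym ab) ac.
case: ac aa1 le_an => {a c} [a c ac hc|a a2 c aa2 a2c] aa1 le_an.
  by case: (irr _ _ ac hc _ aa1).
have lt1 : (size a1 < n)%N.
  by rewrite (leq_trans _ le_an) // (cyclic_cancel_size aa1).
have lt2 : (size a2 < n)%N.
  by rewrite (leq_trans _ le_an) // (cyclic_cancel_size aa2).
have [a12|[d a1d a2d]] := cyclic_cancel_diamond aa1 aa2.
  exact: IHn lt1 a1b (reduces_to_rot a12 a2c).
(* An irreducible form of the common reduct [d] is one for both [a1] and [a2], which are shorter
   than [a]. *)
have [e de] := reduces_to_exists d.
apply: same_cyclic_trans (IHn _ _ _ lt1 a1b (reduces_to_cancel a1d de)) _.
apply: same_cyclic_sym.
exact: IHn _ _ _ lt2 a2c (reduces_to_cancel a2d de).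
Qed.

Lemma conjugate_reduces_to u v w :
  conjugate u v -> reduces_to u w <-> reduces_to v w.
Proof.
move=> uv; elim: uv w => {u v} [//|u v _ IH|v u w _ IH1 _ IH2|u v|x w] z.
- by rewrite IH.
- by rewrite IH1.
- by split; apply: reduces_to_rot; exact: same_cyclic_cat.
have c : cyclic_cancel [:: x, inv x & w] w.
  by exists x, w; split; exact: same_cyclic_refl.
split=> [h|]; last exact: reduces_to_cancel.
(* Reducing [w] further gives some [y]. Uniqueness identifies it with [z] up to rotation, so the
   reduction of [w] to [y] also serves for [z]. *)
have [y wy] := reduces_to_exists w.
have zy := reduces_to_unique (reduces_to_cancel c wy) h.
elim: wy zy {h c} => {w y} [a b ab hb|a b d ab _ IH] dz.
  apply: reduces_to_irreducible (same_cyclic_trans ab dz) _.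
  by case: dz => k ->; rewrite rot_cycle.
exact: reduces_to_cancel ab (IH dz).
Qed.

Theorem conjugate_irreducible u v :
  conjugate u v -> cycle noninverse u -> cycle noninverse v ->
  same_cyclic u v.
Proof.
move=> uv hu hv; apply: reduces_to_unique (_ : reduces_to u u) _.
  by apply: reduces_to_irreducible hu; exact: same_cyclic_refl.
rewrite (conjugate_reduces_to _ uv).
by apply: reduces_to_irreducible hv; exact: same_cyclic_refl.
Qed.

End CyclicWords.

(** * Homotopies of closed lines and of paths *)

Lemma path_zip (T : Type) (e : rel T) A r :
  path e A r = all (fun XY => e XY.1 XY.2) (zip (belast A r) r).
Proof. by elim: r A => //= B r IHr A; rewrite IHr. Qed.

Section Homotopy.
Variables (R : realType) (N : set (plane R)).
Implicit Types (A B C X : plane R) (l r t u v : seq (plane R)).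

(** Made boolean so that the library theory of [path] and [cycle] applies. *)
Definition segment_in : rel (plane R) :=
  fun A B => `[< (segment A B `<=` N)%classic >].

Lemma closed_lineP l : closed_line_in N l <-> l <> [::] /\ cycle segment_in l.
Proof.
case: l => [|A t]; first by split=> -[].
split=> -[_ h]; split=> //=.
  rewrite path_zip belast_rcons; apply/allP => -[X Y] XY; apply/asboolP/h.
  by rewrite rot1_cons.
move: h => /=; rewrite path_zip belast_rcons => /allP h X Y.
by rewrite rot1_cons => /h /asboolP.
Qed.

Lemma closed_line_same_cyclic l l' :
  same_cyclic l l' -> closed_line_in N l -> closed_line_in N l'.
Proof.
move=> [k ->] /closed_lineP[l0 hl]; apply/closed_lineP; rewrite rot_cycle.
by split=> // /(congr1 size); rewrite size_rot => /size0nil.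
Qed.

Lemma elementary_cancellation_same_cyclic l m l' m' :
  same_cyclic l m -> same_cyclic l' m' ->
  elementary_cancellation N l l' -> elementary_cancellation N m m'.
Proof.
move=> lm lm' [B [C [r [hl tri hl']]]]; exists B, C, r; split => //.
  exact: same_cyclic_trans (same_cyclic_sym lm) hl.
exact: same_cyclic_trans (same_cyclic_sym lm') hl'.
Qed.

Lemma homotopic_same_cyclic l l' :
  closed_line_in N l -> same_cyclic l l' -> homotopic N l l'.
Proof.
move=> hl ll'; exists 0%N, (fun=> l).
by split=> //; [exact: same_cyclic_refl | exact: same_cyclic_sym].
Qed.

Lemma homotopic_refl l : closed_line_in N l -> homotopic N l l.
Proof. by move=> hl; apply: homotopic_same_cyclic (same_cyclic_refl l). Qed.

Lemma homotopic_sym l l' : homotopic N l l' -> homotopic N l' l.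
Proof.
move=> [k [L [L0 Lk clL stL]]]; exists k, (fun i => L (k - i)%N).
rewrite subn0 subnn; split=> // [i _|i ik]; first by apply/clL/leq_subr.
have -> : (k - i = (k - i.+1).+1)%N by lia.
by apply/or_comm/stL; lia.
Qed.

Lemma homotopic_trans l' l l'' :
  homotopic N l l' -> homotopic N l' l'' -> homotopic N l l''.
Proof.
move=> [k [L [L0 Lk clL stL]]] [m [M [M0 Mm clM stM]]].
have LM : same_cyclic (L k) (M 0%N).
  exact: same_cyclic_trans (same_cyclic_sym Lk) M0.
exists (k + m)%N, (fun i => if (i <= k)%N then L i else M (i - k)%N).
split=> // [|i ikm|i ikm].
- case: ifPn => [km|_]; last by rewrite addKn.
  have m0 : m = 0%N by lia.
  rewrite m0 addn0 in Mm *; apply: same_cyclic_trans Mm _.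
  exact: same_cyclic_sym.
- case: ifPn => [/clL//|ik]; apply: clM; lia.
case: (ltngtP i k) => [ik|ik|ik]; first exact: stL.
  by rewrite subSn ?(ltnW ik) //; apply: stM; lia.
(* At the junction [L k] and [M 0] are only rotations of each other, so the first step of [M] has to
   be transported to [L k]. *)
have ML : same_cyclic (M 0%N) (L k) by exact: same_cyclic_sym.
have MM := same_cyclic_refl (M 1%N).
rewrite ik subSnn; have [|h|h] := stM 0%N; first lia.
- by left; exact: elementary_cancellation_same_cyclic h.
- by right; exact: elementary_cancellation_same_cyclic h.
Qed.

Lemma homotopic_cancel l l' :
  closed_line_in N l -> closed_line_in N l' ->
  elementary_cancellation N l l' -> homotopic N l l'.
Proof.
move=> hl hl' ll'; exists 1%N, (fun i => if i == 0%N then l else l').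
split=> [||i _|[|//] _]; try exact: same_cyclic_refl; last by left.
by case: ifP.
Qed.

Lemma segment_triangle12 A B C : (segment A B `<=` triangle A B C)%classic.
Proof.
move=> X [a [b [a0 b0 ab ->]]]; exists a, b, 0; split=> //; first by rewrite addr0.
by rewrite scale0r addr0.
Qed.

Lemma segment_triangle23 A B C : (segment B C `<=` triangle A B C)%classic.
Proof.
move=> X [a [b [a0 b0 ab ->]]]; exists 0, a, b; split=> //; first by rewrite add0r.
by rewrite scale0r add0r.
Qed.

Lemma segment_triangle13 A B C : (segment A C `<=` triangle A B C)%classic.
Proof.
move=> X [a [b [a0 b0 ab ->]]]; exists a, 0, b; split=> //; first by rewrite addr0.
by rewrite scale0r addr0.
Qed.

(** The removed vertex has [C] after it and the start [A] is not listed in [r], so both ends of the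
    path stay fixed. *)
Definition path_step A r r' := exists u B C v,
  [/\ r = u ++ [:: B, C & v], r' = u ++ C :: v &
      (triangle (last A u) B C `<=` N)%classic].

(* Homotopy, relative to the endpoints, of the polygonal paths A :: r. *)
Inductive path_homotopic A : seq (plane R) -> seq (plane R) -> Prop :=
| path_homotopic_refl r : path_homotopic A r r
| path_homotopic_step r r' : path_step A r r' -> path_homotopic A r r'
| path_homotopic_sym r r' : path_homotopic A r r' -> path_homotopic A r' r
| path_homotopic_trans r' r r'' :
    path_homotopic A r r' -> path_homotopic A r' r'' -> path_homotopic A r r''.

Lemma path_homotopic_last A r r' : path_homotopic A r r' -> last A r = last A r'.
Proof.
elim=> {r r'} [//|r r' [u [B [C [v [-> -> _]]]]]|//|r' r r'' _ -> _ ->//].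
by rewrite !last_cat.
Qed.

Lemma path_homotopic_path A r r' :
  path_homotopic A r r' -> path segment_in A r = path segment_in A r'.
Proof.
elim=> {r r'} [//|r r' [u [B [C [v [-> -> tri]]]]]|//|r' r r'' _ -> _ ->//].
rewrite !cat_path /=; set D := last A u in tri *.
have -> : segment_in D B.
  by apply/asboolP => X /(@segment_triangle12 D B C)/tri.
have -> : segment_in B C.
  by apply/asboolP => X /(@segment_triangle23 D B C)/tri.
have -> : segment_in D C; last by [].
by apply/asboolP => X /(@segment_triangle13 D B C)/tri.
Qed.

Lemma path_homotopic_size A r r' :
  path_homotopic A r r' -> (r == [::]) = (r' == [::]).
Proof.
elim=> {r r'} [//|r r' [u [B [C [v [-> -> _]]]]]|//|r' r r'' _ -> _ ->//].
by case: u.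
Qed.

Lemma path_homotopic_cat A u r r' v :
  path_homotopic (last A u) r r' -> path_homotopic A (u ++ r ++ v) (u ++ r' ++ v).
Proof.
elim=> {r r'} [r|r r' [w [B [C [x [-> -> tri]]]]]|r r' _|r' r r'' _ IH1 _].
- exact: path_homotopic_refl.
- apply: path_homotopic_step; exists (u ++ w), B, C, (x ++ v).
  by rewrite -!catA last_cat.
- exact: path_homotopic_sym.
- exact: path_homotopic_trans.
Qed.

Lemma closed_path_line A r :
  r != [::] -> path segment_in A r -> last A r = A -> closed_line_in N r.
Proof.
case: r => // B r _ hp hA; apply/closed_lineP; split=> //.
by rewrite -hA /= in hp *; rewrite rcons_path andbC.
Qed.

(** The closed line of a path from [A] back to [A] is [r] alone: its last vertex already accounts
    for [A]. *)
Lemma path_homotopic_homotopic A r r' :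
  path_homotopic A r r' -> r != [::] -> path segment_in A r -> last A r = A ->
  homotopic N r r'.
Proof.
elim=> {r r'} [r|r r' st|r r' rr' IH|r' r r'' rr' IH1 r'r'' IH2] r0 hp hA.
- by apply/homotopic_refl/closed_path_line; eassumption.
- have rr' := path_homotopic_step st.
  apply: homotopic_cancel; first exact: closed_path_line hA.
    apply: (@closed_path_line A); first by rewrite -(path_homotopic_size rr').
      by rewrite -(path_homotopic_path rr').
    by rewrite -(path_homotopic_last rr').
  case: st => u [B [C [v [er er' tri]]]]; exists B, C, (v ++ u).
  rewrite er er'; split; [exact: same_cyclic_cat | | exact: same_cyclic_cat].
  (* When [u] is empty, the cyclic predecessor of [B] is the final vertex of the path, which is [A]
     because the path closes up. *)
  rewrite last_cat; move: tri; rewrite -{1}hA er last_cat /=.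
  by case: (u).
- apply/homotopic_sym/IH.
  + by rewrite (path_homotopic_size rr').
  + by rewrite (path_homotopic_path rr').
  + by rewrite (path_homotopic_last rr').
- apply: homotopic_trans (IH1 _ _ _) (IH2 _ _ _) => //.
  + by rewrite -(path_homotopic_size rr').
  + by rewrite -(path_homotopic_path rr').
  + by rewrite -(path_homotopic_last rr').
Qed.

(** The triangle with two vertices at [B] degenerates to the segment ending at [B]. *)
Lemma path_homotopic_dup A u B v :
  segment_in (last A u) B ->
  path_homotopic A (u ++ [:: B, B & v]) (u ++ B :: v).
Proof.
move=> /asboolP AB; apply: path_homotopic_step; exists u, B, B, v; split=> //.
move=> X [a [b [c [a0 b0 c0 abc ->]]]]; apply: AB.
exists a, (b + c); split=> //; [exact: addr_ge0| by rewrite addrA |].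
by rewrite scalerDl addrA.
Qed.

Definition convex_set (K : set (plane R)) :=
  forall A B C, K A -> K B -> K C -> (triangle A B C `<=` K)%classic.

Lemma convex_segment_in (K : set (plane R)) A B :
  convex_set K -> (K `<=` N)%classic -> K A -> K B -> segment_in A B.
Proof.
move=> cK KN KA KB; apply/asboolP => X /(@segment_triangle12 A B B) h.
exact/KN/(cK A B B).
Qed.

Lemma path_homotopic_convex_nil (K : set (plane R)) A u m C v :
  convex_set K -> (K `<=` N)%classic -> K (last A u) -> K C ->
  (forall B, B \in m -> K B) ->
  path_homotopic A (u ++ m ++ C :: v) (u ++ C :: v).
Proof.
move=> cK KN KA KC; elim: m => [|B m IHm] Km; first exact: path_homotopic_refl.
have KB : K B by apply: Km; rewrite inE eqxx.
case: m IHm Km => [|D m] IHm Km.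
  apply: path_homotopic_step; exists u, B, C, v; split=> //.
  by move=> X /(cK _ _ _ KA KB KC)/KN.
have KD : K D by apply: Km; rewrite !inE eqxx orbT.
apply: path_homotopic_trans (IHm _); last first.
  by move=> E Em; apply: Km; rewrite inE Em orbT.
apply: path_homotopic_step; exists u, B, D, (m ++ C :: v); split=> //.
by move=> X /(cK _ _ _ KA KB KD)/KN.
Qed.

(** Inside a convex puncture-free set both detours contract to the direct segment. Nearly all later
    deformations are chains of this move for suitable [K]. *)
Lemma path_homotopic_convex (K : set (plane R)) A u m m' C v :
  convex_set K -> (K `<=` N)%classic -> K (last A u) -> K C ->
  (forall B, B \in m -> K B) -> (forall B, B \in m' -> K B) ->
  path_homotopic A (u ++ m ++ C :: v) (u ++ m' ++ C :: v).
Proof.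
move=> cK KN KA KC Km Km'.
apply: path_homotopic_trans (path_homotopic_convex_nil _ cK KN KA KC Km) _.
exact/path_homotopic_sym/(path_homotopic_convex_nil _ cK KN KA KC Km').
Qed.

Lemma closed_line_vertex l X : closed_line_in N l -> X \in l -> N X.
Proof.
move=> hl /rot_to[k t et].
have /closed_lineP[_ /=] : closed_line_in N (X :: t).
  by apply: closed_line_same_cyclic hl; exists k.
by case: t {et} => [|Y t] /= /andP[/asboolP XN _]; apply: XN;
  exists 1, 0; rewrite scale1r scale0r !addr0; split.
Qed.

End Homotopy.

(** * Half-planes, segments and intersections as convex sets *)

Section ConvexSets.
Variable R : realType.
Implicit Types (A B C X : plane R) (K : set (plane R)).

Lemma plane_eq A B : A.1 = B.1 -> A.2 = B.2 -> A = B.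
Proof. by case: A B => [x y] [x' y'] /= -> ->. Qed.

Definition halfplane (a b c : R) : set (plane R) :=
  [set X | a * X.1 + b * X.2 <= c]%classic.

Lemma halfplane_convex a b c : convex_set (halfplane a b c).
Proof.
move=> A B C hA hB hC X [x [y [z [x0 y0 z0 xyz ->]]]].
rewrite /halfplane /= in hA hB hC *.
have -> : a * (x *: A + y *: B + z *: C).1 + b * (x *: A + y *: B + z *: C).2 =
  x * (a * A.1 + b * A.2) + y * (a * B.1 + b * B.2) + z * (a * C.1 + b * C.2).
  by rewrite /= /GRing.scale /=; ring.
have -> : c = x * c + y * c + z * c by rewrite -!mulrDl xyz mul1r.
by rewrite !lerD // ler_wpM2l.
Qed.

Lemma convex_setI K K' :
  convex_set K -> convex_set K' -> convex_set (K `&` K')%classic.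
Proof.
move=> cK cK' A B C [KA KA'] [KB KB'] [KC KC'] X h.
by split; [exact: cK h | exact: cK' h].
Qed.

Lemma segment_convex A B : convex_set (segment A B).
Proof.
move=> X Y Z [a [a' [? ? ea ->]]] [b [b' [? ? eb ->]]] [c [c' [? ? ec ->]]].
move=> W [x [y [z [? ? ? exyz ->]]]].
exists (x * a + y * b + z * c), (x * a' + y * b' + z * c'); split.
- by rewrite !addr_ge0 // mulr_ge0.
- by rewrite !addr_ge0 // mulr_ge0.
- transitivity (x * (a + a') + y * (b + b') + z * (c + c')); first by ring.
  by rewrite ea eb ec !mulr1.
- by apply: plane_eq; rewrite /= /GRing.scale /=; ring.
Qed.

Lemma segment_l A B : segment A B A.
Proof. by exists 1, 0; rewrite scale1r scale0r !addr0; split. Qed.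

Lemma segment_r A B : segment A B B.
Proof. by exists 0, 1; rewrite scale1r scale0r !add0r; split. Qed.

End ConvexSets.

(** * The word of a closed line *)

Section Lexicographic.
Variable R : realType.
Implicit Types (A B C X Y : plane R) (e : R).

Definition lexlt : rel (plane R) :=
  fun A B => (A.1 < B.1) || ((A.1 == B.1) && (A.2 < B.2)).

Lemma lexltP A B : reflect (A.1 < B.1 \/ A.1 = B.1 /\ A.2 < B.2) (lexlt A B).
Proof.
apply: (iffP orP) => -[|]; [by left | | by left |].
  by move=> /andP[/eqP]; right.
by move=> [-> ->]; right; rewrite eqxx.
Qed.

Lemma lexlt_trans : transitive lexlt.
Proof. by move=> B A C /lexltP hAB /lexltP hBC; apply/lexltP; lra. Qed.

Lemma lexlt_irr A : lexlt A A = false.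
Proof. by apply/negbTE/lexltP; lra. Qed.

Lemma lexlt_asym A B : lexlt A B -> lexlt B A = false.
Proof. by move=> AB; apply/negbTE/negP => /(lexlt_trans AB); rewrite lexlt_irr. Qed.

Lemma lexlt_total A B : [\/ A = B, lexlt A B | lexlt B A].
Proof.
have [AB|AB|e1] := ltgtP A.1 B.1.
- by constructor 2; apply/lexltP; left.
- by constructor 3; apply/lexltP; left.
have [AB|AB|e2] := ltgtP A.2 B.2.
- by constructor 2; apply/lexltP; right.
- by constructor 3; apply/lexltP; right.
by constructor 1; exact: plane_eq.
Qed.

(** This makes the infinitesimal shear an actual one: only finitely many strict inequalities have to
    survive it. *)
Lemma lexlt_shear (s : seq (plane R * plane R)) :
  exists2 e, 0 < e & forall A B, (A, B) \in s -> lexlt A B ->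
    A.1 + e * A.2 < B.1 + e * B.2.
Proof.
pose good (e : R) (s : seq (plane R * plane R)) := forall A B, (A, B) \in s -> lexlt A B ->
    A.1 + e * A.2 < B.1 + e * B.2.
(* Claiming the inequality for all smaller shears too allows taking the minimum in the induction. *)
suff [e e0 he] : exists2 e, 0 < e & forall e', 0 < e' -> e' <= e -> good e' s.
  by exists e => //; exact: he.
elim: s => [|[A B] s [e e0 he]]; first by exists 1.
have [d d0 hd] : exists2 d, 0 < d & forall e', 0 < e' -> e' <= d ->
    lexlt A B -> A.1 + e' * A.2 < B.1 + e' * B.2.
  have [AB|nAB] := boolP (A.1 < B.1); last first.
    exists 1 => // e' e'0 _ /lexltP [h|[-> h]]; first by rewrite h in nAB.
    by rewrite ltrD2l ltr_pM2l.
  have M0 : 0 < `|A.2 - B.2| + 1 by rewrite ltr_wpDl.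
  (* Up to this bound the displacement [e' * (A.2 - B.2)] stays below [B.1 - A.1]; the added 1 keeps
     the denominator positive. *)
  exists ((B.1 - A.1) / (`|A.2 - B.2| + 1)).
    by rewrite divr_gt0 // subr_gt0.
  move=> e' e'0; rewrite ler_pdivlMr // => h _.
  have := ler_norm (A.2 - B.2); move: (`|_|) => m in h *; nra.
exists (Num.min d e); first by rewrite lt_min d0.
move=> e' e'0; rewrite le_min => /andP[e'd e'e] X Y.
rewrite inE => /orP[/eqP[-> ->]|]; [exact: hd | exact: he].
Qed.

(* Negative when X lies to the right of AB. *)
Definition area A B X : R :=
  (B.1 - A.1) * (X.2 - A.2) - (B.2 - A.2) * (X.1 - A.1).

Lemma area_swap A B X : area B A X = - area A B X.
Proof. by rewrite /area; ring. Qed.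

(** The three quotients of areas are the barycentric coordinates of [X]. *)
Lemma triangle_barycentric A B C X :
  area A B C != 0 -> 0 <= area B C X / area A B C ->
  0 <= area C A X / area A B C -> 0 <= area A B X / area A B C ->
  triangle A B C X.
Proof.
move=> D0 a0 b0 c0; exists (area B C X / area A B C), (area C A X / area A B C),
  (area A B X / area A B C); split=> //.
  by rewrite -!mulrDl -[RHS](divff D0); congr (_ / _); rewrite /area; ring.
have e1 : area A B C * X.1 = area B C X * A.1 + area C A X * B.1 + area A B X * C.1.
  by rewrite /area; ring.
have e2 : area A B C * X.2 = area B C X * A.2 + area C A X * B.2 + area A B X * C.2.
  by rewrite /area; ring.
apply: plane_eq; rewrite /= /GRing.scale /=.
  by rewrite -[LHS](mulKf D0) e1; field.
by rewrite -[LHS](mulKf D0) e2; field.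
Qed.

Lemma triangle_area A B C X :
  0 <= area B C X -> 0 <= area C A X -> 0 <= area A B X ->
  0 < area B C X + area C A X + area A B X -> triangle A B C X.
Proof.
have -> : area B C X + area C A X + area A B X = area A B C by rewrite /area; ring.
by move=> a0 b0 c0 D0; apply: triangle_barycentric;
  rewrite ?gt_eqF // divr_ge0 // ltW.
Qed.

Lemma triangle_area_neg A B C X :
  area B C X <= 0 -> area C A X <= 0 -> area A B X <= 0 ->
  area B C X + area C A X + area A B X < 0 -> triangle A B C X.
Proof.
have -> : area B C X + area C A X + area A B X = area A B C by rewrite /area; ring.
by move=> a0 b0 c0 D0; apply: triangle_barycentric;
  rewrite ?lt_eqF // -mulrNN -invrN divr_ge0 ?oppr_ge0 // ltW.
Qed.

(** [X] is the barycentre of [A], [B], [C] with these areas as weights, and [L] is affine. Knowing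
    on which side of [X] each vertex lies thus constrains the signs of the areas. *)
Lemma area_relation e A B C X : let L Y := Y.1 + e * Y.2 in
  area B C X * (L A - L X) + area C A X * (L B - L X) +
  area A B X * (L C - L X) = 0.
Proof. by rewrite /= /area; ring. Qed.

(** If the two signs differed, [area_relation] would force the third area to have the sign that puts
    [X] inside the triangle. *)
Lemma triangle_lex A B C X : ~ triangle A B C X ->
  lexlt A X -> lexlt X C -> lexlt X B \/ lexlt B X ->
  if lexlt X B then (area A B X < 0) = (area A C X < 0)
  else (area B C X < 0) = (area A C X < 0).
Proof.
move=> nX AX XC XB.
have pos : 0 <= area B C X -> 0 <= area C A X -> 0 <= area A B X ->
    0 < area B C X + area C A X + area A B X -> False.
  by move=> *; apply: nX; exact: triangle_area.
have neg : area B C X <= 0 -> area C A X <= 0 -> area A B X <= 0 ->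
    area B C X + area C A X + area A B X < 0 -> False.
  by move=> *; apply: nX; exact: triangle_area_neg.
(* Lexicographic comparisons become comparisons of a single affine function, to which the linear
   relation applies. *)
have [e _ he] := lexlt_shear [:: (A, X); (X, C); (X, B); (B, X)].
have := area_relation e A B C X; rewrite /=.
have := he A X _ AX; have := he X C _ XC; have := he X B; have := he B X.
rewrite !inE !eqxx ?orbT => /(_ isT) + /(_ isT) + /(_ isT) + /(_ isT).
move: pos neg; rewrite [area C A X]area_swap.
move: (area A B X) (area B C X) (area A C X) => g a b pos neg.
move: (X.1 + _) (A.1 + _) (B.1 + _) (C.1 + _) => x lA lB lC hBX hXB hC hA rel.
case: ifPn XB => [/hXB hB _|nXB [//|/hBX hB]]; last first.
  have [a0|a0] := ltP a 0; have [b0|b0] := ltP b 0 => //; exfalso.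
    by have g0 : g < 0 by [nra]; apply: neg; lra.
  by have g0 : 0 < g by [nra]; apply: pos; lra.
have [g0|g0] := ltP g 0; have [b0|b0] := ltP b 0 => //; exfalso.
  by have a0 : a < 0 by [nra]; apply: neg; lra.
by have a0 : 0 < a by [nra]; apply: pos; lra.
Qed.

Definition crosses A B X := [&& lexlt A X, lexlt X B & area A B X < 0].

Lemma crosses_lexlt A B X : crosses A B X -> lexlt A B.
Proof. by case/and3P => /lexlt_trans h /h. Qed.

(** Only one of the edges [AB], [BC] spans the position of [X]. Since [X] is outside the triangle,
    that edge and [AC] pass on the same side of it. *)
Lemma crosses_split A B C X : ~ triangle A B C X -> lexlt A B -> lexlt B C ->
  crosses A C X = if lexlt X B then crosses A B X else crosses B C X.
Proof.
move=> nX AB BC; have XB : lexlt X B \/ lexlt B X.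
  case: (lexlt_total X B) => [eX||]; [|by left|by right].
  by case: nX; rewrite eX; apply: segment_triangle12; exact: segment_r.
have h := triangle_lex nX _ _ XB; rewrite /crosses; move: h.
case: ifPn XB => [XB _|_ [//|BX]] h.
  have XC := lexlt_trans XB BC; rewrite XC ?XB /=.
  by case: (boolP (lexlt A X)) => //= AX; rewrite h.
have AX := lexlt_trans AB BX; rewrite AX BX /=.
by case: (boolP (lexlt X C)) => //= XC; rewrite h.
Qed.

End Lexicographic.

(** [P] cuts off an initial part of the sorted list, so everything selected by [a] precedes
    everything selected by [b]. Below, [P] holds for the punctures to the left of the middle
    vertex. *)
Lemma filter_sorted_split (T : eqType) (r : rel T) (P a b c : pred T) s :
  transitive r -> sorted r s ->
  (forall x y, r x y -> P y -> P x) ->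
  (forall x, x \in s -> c x = if P x then a x else b x) ->
  (forall x, a x -> P x) -> (forall x, b x -> ~~ P x) ->
  filter a s ++ filter b s = filter c s.
Proof.
move=> tr; elim: s => //= x s IHs xs hP hc ha hb.
have {}IHs : filter a s ++ filter b s = filter c s.
  apply: IHs => //; first exact: path_sorted xs.
  by move=> y ys; apply: hc; rewrite inE ys orbT.
rewrite hc ?inE ?eqxx //; case: (boolP (P x)) => Px.
  case: (boolP (b x)) => [/hb|_]; first by rewrite Px.
  by case: (a x); rewrite //= IHs.
case: (boolP (a x)) => [/ha|_]; first by rewrite (negbTE Px).
case: (b x) => //; suff as0 : filter a s = [::] by rewrite -IHs as0.
apply/eqP; rewrite -(negbK (_ == _)) -has_filter -all_predC.
apply/allP => y ys /=; apply/negP => /ha Py.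
move: Px; rewrite (hP x y) //.
by move: xs; rewrite path_sortedE // => /andP[/allP->].
Qed.

(** The letter [(true, i)] stands for crossing the ray of puncture [i] from left to right,
    [(false, i)] for crossing it from right to left. *)
Definition flip (x : bool * nat) := (~~ x.1, x.2).

Lemma flipK : involutive flip.
Proof. by case=> b i; rewrite /flip /= negbK. Qed.

Lemma flip_neq x : flip x != x.
Proof. by case: x => -[]. Qed.

Section Words.
Variables (R : realType) (q : nat -> plane R) (s : seq nat).
Implicit Types (A B C : plane R) (l r : seq (plane R)).

(* The rays going up from the punctures which the segment AB crosses, in order;
   each ray is tilted infinitesimally to the left, so that the lexicographic
   order tells on which side of it a point is. *)
Definition edge_word A B : seq (bool * nat) :=
  [seq (true, i) | i <- s & crosses A B (q i)] ++
  [seq (false, i) | i <- rev s & crosses B A (q i)].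

Lemma edge_word_inv A B : inv_word flip (edge_word A B) = edge_word B A.
Proof.
by rewrite inv_word_cat /inv_word -!map_comp -!map_rev -!filter_rev revK.
Qed.

Lemma edge_word_refl A : edge_word A A = [::].
Proof.
rewrite /edge_word !(@eq_filter _ _ pred0) ?filter_pred0 // => i;
by apply/negbTE/negP => /crosses_lexlt; rewrite lexlt_irr.
Qed.

Lemma edge_word_lexlt A B : lexlt A B ->
  edge_word A B = [seq (true, i) | i <- s & crosses A B (q i)].
Proof.
move=> AB; rewrite /edge_word (@eq_filter _ (fun i => crosses B A _) pred0).
  by rewrite filter_pred0 cats0.
by move=> i; apply/negbTE/negP => /crosses_lexlt; rewrite (lexlt_asym AB).
Qed.

Hypothesis s_sorted : sorted (fun i j => lexlt (q i) (q j)) s.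

Definition punctured : set (plane R) := [set X | forall i, i \in s -> X <> q i]%classic.

Lemma edge_word_split A B C : (triangle A B C `<=` punctured)%classic ->
  A = B \/ lexlt A B -> B = C \/ lexlt B C ->
  edge_word A B ++ edge_word B C = edge_word A C.
Proof.
move=> tri [->|AB]; first by rewrite edge_word_refl.
move=> [<-|BC]; first by rewrite edge_word_refl cats0.
rewrite !edge_word_lexlt //; last exact: lexlt_trans AB BC.
rewrite -map_cat; congr map.
apply: (filter_sorted_split (P := fun i => lexlt (q i) B) _ s_sorted).
- by move=> j i k; exact: lexlt_trans.
- by move=> i j; exact: lexlt_trans.
- by move=> i si; apply: crosses_split => // /tri /(_ i si).
- by move=> i /and3P[].
- by move=> i /and3P[/lexlt_asym->].
Qed.

(** Reversing an edge inverts its word, so the relation among the three edges is invariant under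
    permuting the vertices. This reduces it to vertices in lexicographic order, where it holds
    letter for letter. *)
Lemma edge_word_triangle A B C : (triangle A B C `<=` punctured)%classic ->
  free_eq flip (edge_word A B ++ edge_word B C) (edge_word A C).
Proof.
have rot3 (X Y Z : plane R) : (triangle X Y Z `<=` triangle Y Z X)%classic.
  move=> _ [a [b [c [a0 b0 c0 abc ->]]]]; exists b, c, a; split=> //.
    by rewrite addrC addrA.
  by rewrite [RHS]addrC addrA.
have swap (X Y Z : plane R) : (triangle X Y Z `<=` triangle Z Y X)%classic.
  move=> _ [a [b [c [a0 b0 c0 abc ->]]]]; exists c, b, a; split=> //.
    by rewrite addrC [c + b]addrC addrA.
  by rewrite [RHS]addrC [c *: _ + _]addrC addrA.
pose P X Y Z := free_eq flip (edge_word X Y ++ edge_word Y Z) (edge_word X Z).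
have P_rot X Y Z : P X Y Z -> P Y Z X.
  move=> XYZ; apply: (free_eq_moveR flipK); rewrite edge_word_inv.
  apply/free_eq_sym/free_eq_moveL; rewrite edge_word_inv.
  exact: free_eq_sym.
have P_swap X Y Z : P X Y Z -> P Z Y X.
  move=> /P_rot XYZ; apply: free_eq_moveL; rewrite edge_word_inv.
  exact: free_eq_sym.
pose le (X Y : plane R) := X = Y \/ lexlt X Y.
have base X Y Z : (triangle X Y Z `<=` punctured)%classic -> le X Y -> le Y Z ->
    P X Y Z.
  by move=> tri XY YZ; rewrite /P edge_word_split //; exact: free_eq_refl.
have total X Y : le X Y \/ le Y X.
  by case: (lexlt_total X Y) => ?; [left; left|left; right|right; right].
have sub X Y Z := subset_trans (rot3 X Y Z).
have sub' X Y Z := subset_trans (swap X Y Z).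
move=> tri; have tri1 := sub _ _ _ _ tri; have tri2 := sub _ _ _ _ tri1.
have [AB|BA] := total A B; have [BC|CB] := total B C; have [AC|CA] := total A C.
- exact: base.
- exact: base.
- by apply/P_rot/P_rot/P_swap/base => //; exact: sub'.
- by apply/P_rot/base.
- by apply/P_rot/P_swap/base => //; exact: sub'.
- by apply/P_rot/P_rot/base.
- by apply/P_swap/base => //; exact: sub'.
- by apply/P_swap/base => //; exact: sub'.
Qed.

Definition path_word A r := flatten (pairmap edge_word A r).

Definition line_word l :=
  if l is A :: t then path_word A (rcons t A) else [::].

Lemma path_word_cat A u v :
  path_word A (u ++ v) = path_word A u ++ path_word (last A u) v.
Proof. by rewrite /path_word pairmap_cat flatten_cat. Qed.

Lemma path_word_cons A B r :
  path_word A (B :: r) = edge_word A B ++ path_word B r.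
Proof. by []. Qed.

Lemma line_word_same_cyclic l l' :
  same_cyclic l l' -> same_cyclic (line_word l) (line_word l').
Proof.
case/same_cyclicP => [[|A u] [v [-> ->]]].
  by rewrite cats0; exact: same_cyclic_refl.
case: v => [|B v]; first by rewrite cats0; exact: same_cyclic_refl.
have e X t Y t' : line_word ((X :: t) ++ (Y :: t')) =
    path_word X (rcons t Y) ++ path_word Y (rcons t' X).
  by rewrite /= rcons_cat rcons_cons -cat_rcons path_word_cat last_rcons.
by rewrite !e; exact: same_cyclic_cat.
Qed.

Lemma elementary_cancellation_word l l' :
  elementary_cancellation punctured l l' ->
  conjugate flip (line_word l) (line_word l').
Proof.
move=> [B [C [r [hl tri hl']]]].
apply: conjugate_trans (conjugate_same_cyclic _ (line_word_same_cyclic hl)) _.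
apply: conjugate_trans; last first.
  exact/conjugate_sym/conjugate_same_cyclic/line_word_same_cyclic/hl'.
have -> : line_word [:: B, C & r] =
    edge_word B C ++ path_word C r ++ edge_word (last C r) B.
  by rewrite /= path_word_cons -cats1 path_word_cat /path_word /= cats0.
have -> : line_word (C :: r) = path_word C r ++ edge_word (last C r) C.
  by rewrite /= -cats1 path_word_cat /path_word /= cats0.
(* Rotating the word brings the two edges at [B] together. *)
apply: conjugate_trans (conjugate_cat _ _ _) _.
apply/free_eq_conjugate; rewrite -catA; apply: free_eq_cat.
  exact: free_eq_refl.
exact: edge_word_triangle.
Qed.

Lemma homotopic_word l l' :
  homotopic punctured l l' -> conjugate flip (line_word l) (line_word l').
Proof.
move=> [k [L [L0 Lk _ stL]]].
apply: conjugate_trans (conjugate_same_cyclic _ (line_word_same_cyclic L0)) _.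
apply: conjugate_trans; last first.
  exact/conjugate_sym/conjugate_same_cyclic/line_word_same_cyclic/Lk.
elim: k {Lk} stL => [_|k IHk stL]; first exact: conjugate_refl.
apply: conjugate_trans (IHk _) _; first by move=> i ik; apply/stL/ltnW.
have [|h|h] := stL k; [by [] | exact: elementary_cancellation_word |].
exact/conjugate_sym/elementary_cancellation_word.
Qed.

End Words.

(** * Deforming a line to the canonical line of its word *)

Ltac each_vertex :=
  let X := fresh "X" in
  move=> X; rewrite ?inE ?in_nil; repeat case/orP; move=> // /eqP ->.

Section Between.
Variable R : realType.
Implicit Types u v x y d : R.

Definition between u v x := (u <= x <= v) || (v <= x <= u).

Lemma between_sym u v x : between u v x = between v u x.
Proof. by rewrite /between orbC. Qed.

Lemma between_lt u v x : u < v -> between u v x = (u <= x <= v).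
Proof.
move=> uv; rewrite /between; have [//|_] /= := boolP (u <= x <= v).
by apply/negP; lra.
Qed.

Lemma between_gt u v x : v < u -> between u v x = (v <= x <= u).
Proof. by move=> vu; rewrite between_sym between_lt. Qed.

Lemma between_trans u v x y : between u v x -> between u x y -> between u v y.
Proof.
rewrite /between => /orP[]/andP[? ?] /orP[]/andP[? ?]; apply/orP;
by [left; apply/andP; split; lra | right; apply/andP; split; lra].
Qed.

(** The interval between [u] and [x - d] lies in [u, x] if [x - d] is at least [u], and within
    distance [d] of [x] otherwise. In both cases [y] is outside. *)
Lemma between_subr_gap u x y d : u < x -> d < `|x - y| ->
  0 < d -> ~~ between u x y -> ~~ between u (x - d) y.
Proof.
move=> ux xy d0; rewrite between_lt // negb_and -!ltNge => hy; apply/negP.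
move: hy xy; rewrite /between; case: (lerP x y) => ? /orP[]? ? /orP[]/andP[? ?]; lra.
Qed.

Lemma between_addr_gap u x y d : x < u -> d < `|x - y| ->
  0 < d -> ~~ between u x y -> ~~ between u (x + d) y.
Proof.
move=> xu xy d0; rewrite between_gt // negb_and -!ltNge => hy; apply/negP.
move: hy xy; rewrite /between; case: (lerP x y) => ? /orP[]? ? /orP[]/andP[? ?]; lra.
Qed.

Lemma between_interior u v x y d :
  between u v x -> between u v y -> x + d < y -> 0 < d -> u != v ->
  if u < v then u < x + d < v else v < x + d < u.
Proof.
rewrite /between => hx hy xy d0; case: (ltgtP u v) => // uv _; apply/andP;
by case/orP: hx => /andP[? ?]; case/orP: hy => /andP[? ?]; split; lra.
Qed.

End Between.

Section CanonicalLines.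
(** The generic situation after a shear. Vertical lines at distance [d] from a puncture meet no
    puncture, and all punctures lie strictly between the heights [- h] and [h]. *)
Variables (R : realType) (q : nat -> plane R) (s : seq nat) (d h : R).
Hypothesis s_sorted : sorted (fun i j => lexlt (q i) (q j)) s.
Hypothesis d_gt0 : 0 < d.
Hypothesis gap : forall i j, i \in s -> j \in s -> i != j ->
  d < `|(q i).1 - (q j).1|.
Hypothesis height : forall i, i \in s -> - h < (q i).2 < h.
Implicit Types (A B C M X : plane R) (r : seq (plane R)) (u v x y : R).
Local Notation N := (punctured q s).
Local Notation "r ~~> r'" := (path_homotopic N (0, - h) r r') (at level 70).

Definition low x : plane R := (x, - h).
Definition high x : plane R := (x, h).
Local Notation O := (low 0).

Definition bottom := @halfplane R 0 1 (- h).
Definition top := @halfplane R 0 (-1) (- h).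
(** The bounds may come in either order, so edges running left and right are treated alike. *)
Definition strip u v :=
  (halfplane (-1) 0 (- Num.min u v) `&` halfplane 1 0 (Num.max u v))%classic.

Lemma stripE u v X : strip u v X <-> between u v X.1.
Proof.
rewrite /strip /between /setI /halfplane /=.
case: (lerP u v) => uv; split=> [[? ?]|/orP[]/andP[? ?]]; try (by split; lra).
  by apply/orP; left; apply/andP; split; lra.
by apply/orP; right; apply/andP; split; lra.
Qed.

Lemma strip_convex u v : convex_set (strip u v).
Proof. by apply: convex_setI; exact: halfplane_convex. Qed.

Lemma stripl u v X : X.1 = u -> strip u v X.
Proof. by move=> e; apply/stripE; rewrite /between e; case: (lerP u v) => //=; lra. Qed.

Lemma stripr u v X : X.1 = v -> strip u v X.
Proof. by move=> e; apply/stripE; rewrite /between e; case: (lerP u v) => //=; lra. Qed.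

Lemma bottom_sub : (bottom `<=` N)%classic.
Proof.
move=> X; rewrite /bottom /halfplane /= => hX i /height hi eX.
by rewrite eX in hX; lra.
Qed.

Lemma top_sub : (top `<=` N)%classic.
Proof.
move=> X; rewrite /top /halfplane /= => hX i /height hi eX.
by rewrite eX in hX; lra.
Qed.

Lemma bottom_low x : bottom (low x).
Proof. by rewrite /bottom /halfplane /=; lra. Qed.

Lemma top_high x : top (high x).
Proof. by rewrite /top /halfplane /=; lra. Qed.

Definition free_strip u v := forall i, i \in s -> ~~ between u v (q i).1.

Lemma strip_sub u v : free_strip u v -> (strip u v `<=` N)%classic.
Proof. by move=> fr X /stripE hX i /fr /negP hi eX; apply: hi; rewrite -eX. Qed.

Lemma replace_inside (K : set (plane R)) r w w' C t :
  convex_set K -> (K `<=` N)%classic ->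
  (forall B, B \in [:: last O r, C & w ++ w'] -> K B) ->
  r ++ w ++ C :: t ~~> r ++ w' ++ C :: t.
Proof.
move=> cK KN hK; apply: (path_homotopic_convex (K := K)) => //.
- by apply: hK; rewrite inE eqxx.
- by apply: hK; rewrite !inE eqxx orbT.
- by move=> B Bw; apply: hK; rewrite !inE mem_cat Bw !orbT.
- by move=> B Bw; apply: hK; rewrite !inE mem_cat Bw !orbT.
Qed.

Lemma replace_bottom r w w' C t :
  (forall B, B \in [:: last O r, C & w ++ w'] -> bottom B) ->
  r ++ w ++ C :: t ~~> r ++ w' ++ C :: t.
Proof. exact: replace_inside (@halfplane_convex _ _ _ _) bottom_sub. Qed.

Lemma replace_top r w w' C t :
  (forall B, B \in [:: last O r, C & w ++ w'] -> top B) ->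
  r ++ w ++ C :: t ~~> r ++ w' ++ C :: t.
Proof. exact: replace_inside (@halfplane_convex _ _ _ _) top_sub. Qed.

Lemma replace_strip u v r w w' C t : free_strip u v ->
  (forall B, B \in [:: last O r, C & w ++ w'] -> B.1 = u \/ B.1 = v) ->
  r ++ w ++ C :: t ~~> r ++ w' ++ C :: t.
Proof.
move=> fr hb; apply: replace_inside (strip_convex (u := u) (v := v)) _ _.
  exact: strip_sub.
by move=> B /hb[?|?]; [exact: stripl | exact: stripr].
Qed.

(** [K] reaches from the edge down to the base line, so the edge drops and its lift moves from [A]
    to [B]. *)
Lemma edge_below (K : set (plane R)) A B :
  convex_set K -> (K `<=` N)%classic ->
  K A -> K B -> K (low A.1) -> K (low B.1) ->
  [:: low A.1; A; B] ~~> [:: low B.1; B].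
Proof.
move=> cK KN KA KB KA' KB'.
apply: (@path_homotopic_trans _ _ _ [:: low A.1; low B.1; B]).
  apply: (@path_homotopic_convex _ _ K _ [:: low A.1] [:: A] [:: low B.1]) => //;
  by each_vertex.
by apply: (@replace_bottom [::] [:: low A.1] [::]); each_vertex; exact: bottom_low.
Qed.

(** The base point is left out as start and listed as end, so that handles compose by
    concatenation. *)
Definition handle u v := [:: low u; high u; high v; low v; O].

(** Here [K] is free above the edge. The edge is raised to height [h], which leaves an arch over [A]
    and [B]; its vertical sides are then moved to the standard abscissas [u] and [v]. *)
Lemma edge_above (K : set (plane R)) A B u v :
  convex_set K -> (K `<=` N)%classic ->
  K A -> K B -> K (high A.1) -> K (high B.1) ->
  free_strip A.1 A.1 -> free_strip B.1 B.1 ->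
  free_strip A.1 u -> free_strip B.1 v ->
  [:: low A.1; A; B] ~~> handle u v ++ [:: low B.1; B].
Proof.
move=> cK KN KA KB KA' KB' sA sB sAu sBv.
apply: (@path_homotopic_trans _ _ _ [:: low A.1; A; high A.1; high B.1; B]).
  apply: (@path_homotopic_convex _ _ K _ [:: low A.1; A] [::]
    [:: high A.1; high B.1]) => //; by each_vertex.
apply: (@path_homotopic_trans _ _ _ [:: low A.1; high A.1; high B.1; B]).
  by apply: (@replace_strip _ _ [:: low A.1] [:: A] [::] _ [:: high B.1; B] sA);
    each_vertex; left.
apply: (@path_homotopic_trans _ _ _ [:: low A.1; high A.1; high B.1; low B.1; B]).
  by apply: (@replace_strip _ _ [:: low A.1; high A.1; high B.1] [::]
    [:: low B.1] B [::] sB); each_vertex; left.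
(* The ascent slides from [A.1] to [u]; further on, the descent slides likewise from [B.1] to
   [v]. *)
apply: (@path_homotopic_trans _ _ _
  [:: low A.1; low u; high u; high A.1; high B.1; low B.1; B]).
  by apply: (@replace_strip _ _ [:: low A.1] [::] [:: low u; high u] (high A.1)
    [:: high B.1; low B.1; B] sAu); each_vertex; (left + right).
apply: (@path_homotopic_trans _ _ _
  [:: low u; high u; high A.1; high B.1; low B.1; B]).
  by apply: (@replace_bottom [::] [:: low A.1] [::]); each_vertex; exact: bottom_low.
apply: (@path_homotopic_trans _ _ _
  [:: low u; high u; high A.1; high B.1; high v; low v; low B.1; B]).
  by apply: (@replace_strip _ _ [:: low u; high u; high A.1; high B.1] [::]
    [:: high v; low v] (low B.1) [:: B] sBv); each_vertex; (left + right).
apply: (@path_homotopic_trans _ _ _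
  [:: low u; high u; high v; low v; low B.1; B]).
  by apply: (@replace_top [:: low u; high u] [:: high A.1; high B.1] [::]);
    each_vertex; exact: top_high.
by apply: (@replace_bottom [:: low u; high u; high v; low v] [::] [:: O]);
  each_vertex; exact: bottom_low.
Qed.

(* The loop of the letter (b, i) passes above the puncture q i only, to the
   right when b is true. *)
Definition loop (x : bool * nat) :=
  if x.2 \in s then
    if x.1 then handle ((q x.2).1 - d) ((q x.2).1 + d)
    else handle ((q x.2).1 + d) ((q x.2).1 - d)
  else [:: O].

Definition word_path w := flatten (map loop w).

Lemma word_path_cat w w' : word_path (w ++ w') = word_path w ++ word_path w'.
Proof. by rewrite /word_path map_cat flatten_cat. Qed.

Lemma last_loop (x : bool * nat) A : last A (loop x) = O.
Proof. by rewrite /loop; case: ifP => //; case: ifP. Qed.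

Lemma last_word_path w : last O (word_path w) = O.
Proof.
elim/last_ind: w => // w x _.
by rewrite -cats1 word_path_cat last_cat /word_path /= cats0 last_loop.
Qed.


Lemma s_uniq : uniq s.
Proof.
apply: (sorted_uniq _ _ s_sorted) => [j i k|i]; first exact: lexlt_trans.
exact: lexlt_irr.
Qed.

Lemma crosses_between A B X : crosses A B X -> between A.1 B.1 X.1.
Proof. by rewrite /between => /and3P[/lexltP AX /lexltP XB _]; lra. Qed.

Lemma edge_word_nil A B :
  (forall i, i \in s -> ~~ crosses A B (q i) && ~~ crosses B A (q i)) ->
  edge_word q s A B = [::].
Proof.
move=> hs; rewrite /edge_word.
have -> : [seq i <- s | crosses A B (q i)] = [::].
  by apply/eqP; rewrite -(negbK (_ == _)) -has_filter -all_predC; apply/allP => i /hs /andP[].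
have -> // : [seq i <- rev s | crosses B A (q i)] = [::].
apply/eqP; rewrite -(negbK (_ == _)) -has_filter -all_predC; apply/allP => i.
by rewrite mem_rev => /hs /andP[].
Qed.

Lemma edge_word_single A B i : i \in s -> A.1 < B.1 ->
  (forall j, j \in s -> crosses A B (q j) = (j == i)) ->
  edge_word q s A B = [:: (true, i)].
Proof.
move=> si AB hs; rewrite edge_word_lexlt; last by apply/lexltP; left.
by rewrite (eq_in_filter hs) filter_pred1_uniq // s_uniq.
Qed.

Definition generic A :=
  (forall i, i \in s -> (q i).1 != A.1) /\ - h <= A.2 <= h.

Lemma generic_free_strip A : generic A -> free_strip A.1 A.1.
Proof.
move=> [hA _] i /hA; apply: contra; rewrite /between => ?; apply/eqP; lra.
Qed.

Lemma segment_line A B M : A.1 != B.1 ->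
  segment A B M <->
  between A.1 B.1 M.1 /\
  M.2 = A.2 + (B.2 - A.2) / (B.1 - A.1) * (M.1 - A.1).
Proof.
move=> AB; have AB0 : B.1 - A.1 != 0 by rewrite subr_eq0 eq_sym.
split=> [[a [b [a0 b0 ab ->]]]|[hM eM]].
  rewrite /= /GRing.scale /=; have -> : a = 1 - b by lra.
  split; last by field.
  rewrite /between; case: (lerP A.1 B.1) => h1; apply/orP; [left|right];
  apply/andP; split; nra.
have ht : 0 <= (M.1 - A.1) / (B.1 - A.1) <= 1.
  move: hM AB AB0; rewrite /between; case: (ltgtP A.1 B.1) => // h1 hM _ _.
    by rewrite ler_pdivrMr ?subr_gt0 // divr_ge0 //; lra.
  rewrite -mulrNN -invrN !opprB ler_pdivrMr ?subr_gt0 // divr_ge0 //; lra.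
exists (1 - (M.1 - A.1) / (B.1 - A.1)), ((M.1 - A.1) / (B.1 - A.1)).
split; [lra | lra | lra |].
by apply: plane_eq; rewrite /= /GRing.scale /= ?eM; field.
Qed.

(** The part of the strip on the far side of the edge from the puncture is free. With the puncture
    above, the edge drops and its word is empty. With the puncture below, the edge goes over it and
    leaves the loop of the crossed ray. *)
Lemma edge_one_puncture A B i :
  generic A -> generic B -> segment_in N A B -> i \in s ->
  between A.1 B.1 (q i).1 ->
  (forall j, j \in s -> j != i -> ~~ between A.1 B.1 (q j).1) ->
  [:: low A.1; A; B] ~~> word_path (edge_word q s A B) ++ [:: low B.1; B].
Proof.
move=> gA gB AB si bi only_i; have d0 := d_gt0.
have qA := gA.1 _ si; have qB := gB.1 _ si.
have ABn : A.1 != B.1.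
  apply: contraNneq qA => e; apply/eqP; move: bi; rewrite /between e.
  by move=> /orP[]/andP[? ?]; lra.
have bi2 : if A.1 < B.1 then A.1 < (q i).1 /\ (q i).1 < B.1
    else B.1 < (q i).1 /\ (q i).1 < A.1.
  move: bi; case: (ltgtP A.1 B.1) ABn => // lAB _.
    rewrite between_lt // !le_eqVlt (negbTE qB) [_ == (q i).1]eq_sym (negbTE qA).
    by move/andP.
  rewrite between_gt // !le_eqVlt (negbTE qA) [_ == (q i).1]eq_sym (negbTE qB).
  by move/andP.
set c := (B.2 - A.2) / (B.1 - A.1).
have eB : B.2 = A.2 + c * (B.1 - A.1).
  by rewrite /c divfK ?subr_eq0 1?eq_sym //; lra.
have offline : (q i).2 != A.2 + c * ((q i).1 - A.1).
  apply/eqP => e; move/asboolP: AB => /(_ (q i)); case/(_ _ i) => //.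
  exact/(segment_line _ ABn).
have cr X Y j : (X = A /\ Y = B \/ X = B /\ Y = A) -> X.1 < Y.1 -> j \in s ->
    crosses X Y (q j) = (j == i) && ((q i).2 < A.2 + c * ((q i).1 - A.1)).
  move=> XY ltXY sj; have [->|ji] := eqVneq j i; last first.
    apply/negbTE; apply: contra (only_i _ sj ji) => /crosses_between.
    by case: XY => -[-> ->] //; rewrite between_sym.
  have [Xi iY] : X.1 < (q i).1 /\ (q i).1 < Y.1.
    have : between X.1 Y.1 (q i).1 by case: XY => -[-> ->] //; rewrite between_sym.
    rewrite between_lt // !le_eqVlt.
    by case: XY => -[-> ->]; rewrite ?[_ == (q i).1]eq_sym (negbTE qA) (negbTE qB) /= => /andP.
  have lexX : lexlt X (q i) by apply/lexltP; left.
  have lexY : lexlt (q i) Y by apply/lexltP; left.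
  rewrite /crosses lexX lexY /=.
  have -> : area X Y (q i) = (Y.1 - X.1) * ((q i).2 - (A.2 + c * ((q i).1 - A.1))).
    by case: XY => -[-> ->]; rewrite /area eB; ring.
  by rewrite pmulr_rlt0 ?subr_gt0 // subr_lt0.
have [above|below] := ltP (A.2 + c * ((q i).1 - A.1)) (q i).2.
  have {}cr X Y j : (X = A /\ Y = B \/ X = B /\ Y = A) -> j \in s ->
      ~~ crosses X Y (q j).
    move=> XY sj; have [XYl|YXl|e] := ltgtP X.1 Y.1.
    - by rewrite (cr _ _ _ XY XYl sj) negb_and -leNgt (ltW above) orbT.
    - by apply/negP => /crosses_lexlt/lexltP; lra.
    - by case: XY e ABn => -[-> ->] ->; rewrite eqxx.
  rewrite edge_word_nil; last by move=> j sj; rewrite !cr //; [right|left].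
  (* With [c] the slope, this half-plane is the one under the line [AB]; the opposite one serves
     when the puncture is below. *)
  apply: (@edge_below (strip A.1 B.1 `&` halfplane (- c) 1 (A.2 - c * A.1))%classic).
  + by apply: convex_setI; [exact: strip_convex | exact: halfplane_convex].
  + move=> X [/stripE hX]; rewrite /halfplane /= => hX2 j sj eX.
    have [ji|ji] := eqVneq j i; first by rewrite eX ji in hX2; lra.
    by move: (only_i _ sj ji); rewrite -eX hX.
  + by split; [exact: stripl | rewrite /halfplane /=; lra].
  + by split; [exact: stripr | rewrite /halfplane /= eB; lra].
  + split; [exact: stripl | rewrite /halfplane /=].
    by have /andP[? _] := gA.2; lra.
  + split; [exact: stripr | rewrite /halfplane /=].
    by have /andP[] := gB.2; rewrite eB; lra.
have {offline}below : (q i).2 < A.2 + c * ((q i).1 - A.1).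
  by rewrite lt_neqAle offline.
(* Between an endpoint and the side of the loop facing it there is no puncture: [q i] lies beyond
   that side, and the others are kept out by [only_i] and [gap]. *)
have side X u : X = A \/ X = B ->
    (X.1 < (q i).1 /\ u = (q i).1 - d) \/ ((q i).1 < X.1 /\ u = (q i).1 + d) ->
    free_strip X.1 u.
  move=> XAB hu j sj; have [->|ji] := eqVneq j i.
    by apply/negP; rewrite /between; case: hu => -[? ->] /orP[]/andP[? ?]; lra.
  have gij : d < `|(q i).1 - (q j).1| by apply: gap => //; rewrite eq_sym.
  have nij : ~~ between X.1 (q i).1 (q j).1.
    apply: contra (only_i _ sj ji); case: XAB => -> hj.
      exact: between_trans bi hj.
    rewrite between_sym; apply: between_trans hj.
    by rewrite between_sym.
  by case: hu => -[? ->]; [exact: between_subr_gap | exact: between_addr_gap].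
have -> : word_path (edge_word q s A B) =
    handle ((q i).1 + (if A.1 < B.1 then - d else d))
           ((q i).1 + (if A.1 < B.1 then d else - d)).
  case: (ltgtP A.1 B.1) ABn => // lAB _.
    rewrite (edge_word_single si lAB); last by move=> j sj; rewrite cr ?below ?andbT //; left.
    by rewrite /word_path /= cats0 /loop /= si.
  rewrite -edge_word_inv (edge_word_single si lAB); last first.
    by move=> j sj; rewrite cr ?below ?andbT //; right.
  by rewrite /word_path /= cats0 /loop /= si.
apply: (@edge_above (strip A.1 B.1 `&` halfplane c (-1) (c * A.1 - A.2))%classic).
+ by apply: convex_setI; [exact: strip_convex | exact: halfplane_convex].
+ move=> X [/stripE hX]; rewrite /halfplane /= => hX2 j sj eX.
  have [ji|ji] := eqVneq j i; first by rewrite eX ji in hX2; lra.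
  by move: (only_i _ sj ji); rewrite -eX hX.
+ by split; [exact: stripl | rewrite /halfplane /=; lra].
+ by split; [exact: stripr | rewrite /halfplane /= eB; lra].
+ split; [exact: stripl | rewrite /halfplane /=].
  by have /andP[_ ?] := gA.2; lra.
+ split; [exact: stripr | rewrite /halfplane /=].
  by have /andP[_] := gB.2; rewrite eB; lra.
+ exact: generic_free_strip.
+ exact: generic_free_strip.
+ by apply: side; [by left|case: ifP bi2 => _ [? ?]; [left|right]].
+ by apply: side; [by right|case: ifP bi2 => _ [? ?]; [right|left]].
Qed.

(** Induction on the number of punctures whose abscissa lies between those of the ends: an edge
    passing two of them is cut between the two. *)
Lemma edge_canonical A B :
  generic A -> generic B -> segment_in N A B ->
  [:: low A.1; A; B] ~~> word_path (edge_word q s A B) ++ [:: low B.1; B].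
Proof.
have [n] := ubnP (size [seq i <- s | between A.1 B.1 (q i).1]).
have d0 := d_gt0; elim: n A B => // n IHn A B; rewrite ltnS => le_n gA gB AB.
case eI: [seq i <- s | between A.1 B.1 (q i).1] le_n => [|i [|j t]] le_n.
- have fr : free_strip A.1 B.1.
    move=> i si; apply/negP => hi.
    by have := in_nil i; rewrite -eI mem_filter hi si.
  rewrite edge_word_nil.
    apply: (edge_below (strip_convex (u := A.1) (v := B.1))).
    + exact: strip_sub.
    + exact: stripl.
    + exact: stripr.
    + exact: stripl.
    + exact: stripr.
  move=> i /fr hi; apply/andP; split; apply: contra hi => /crosses_between //.
  by rewrite between_sym.
- have := mem_head i [::]; rewrite -eI mem_filter => /andP[hi si].
  apply: edge_one_puncture hi _ => // j sj; apply: contra => hj.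
  have : j \in [seq i <- s | between A.1 B.1 (q i).1] by rewrite mem_filter hj.
  by rewrite eI inE.
rewrite -eI in le_n.
have {eI} [k [k' [sk hk sk' hk' kk']]] : exists k k', [/\ k \in s,
    between A.1 B.1 (q k).1, k' \in s, between A.1 B.1 (q k').1 &
    (q k).1 + d < (q k').1].
  have := filter_uniq (fun i => between A.1 B.1 (q i).1) s_uniq.
  rewrite eI /= inE negb_or => /andP[/andP[ij _] _].
  have := mem_head i (j :: t); rewrite -eI mem_filter => /andP[hi si].
  have : j \in [:: i, j & t] by rewrite !inE eqxx orbT.
  rewrite -eI mem_filter => /andP[hj sj].
  have := gap si sj ij; case: (lerP (q i).1 (q j).1) => le_ij gp.
    by exists i, j; split=> //; lra.
  by exists j, i; split=> //; lra.
have ABn : A.1 != B.1.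
  by apply/eqP => e; move: hk hk'; rewrite /between e => /orP[]/andP[? ?] /orP[]/andP[? ?]; lra.
(* By [gap] this lies left of [q k'], so each half of the edge loses one of the two punctures. No
   puncture has abscissa [x]: those other than [q k] are more than [d] away from it. *)
pose x := (q k).1 + d.
pose M : plane R := (x, A.2 + (B.2 - A.2) / (B.1 - A.1) * (x - A.1)).
have x_in : if A.1 < B.1 then A.1 < x < B.1 else B.1 < x < A.1.
  exact: between_interior hk hk' kk' d0 ABn.
have hx : between A.1 B.1 x.
  case: (ltgtP A.1 B.1) ABn x_in => // lAB _ /andP[/ltW Ax /ltW xB].
    by rewrite between_lt ?Ax.
  by rewrite between_gt ?Ax.
have sM : segment A B M by apply/(segment_line M ABn).
have gM : generic M.
  split=> [l sl|].
    have [->|lk] := eqVneq l k; first by rewrite /= /x; apply/eqP; lra.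
    have := gap sl sk lk; apply: contraTneq => -> /=.
    by rewrite /x addrC addKr ger0_norm ?ltxx // ltW.
  case: sM => a [b [a0 b0 ab ->]]; move: gA.2 gB.2.
  rewrite /= /GRing.scale /=; have -> : a = 1 - b by lra.
  by move=> /andP[? ?] /andP[? ?]; apply/andP; split; nra.
have subAM (X Y : plane R) : segment A B X -> segment A B Y -> segment_in N X Y.
  move=> AX AY; apply: convex_segment_in AX AY; first exact: segment_convex.
  exact/asboolP.
have small (X Y : plane R) l : (forall i, between X.1 Y.1 (q i).1 -> between A.1 B.1 (q i).1) ->
    l \in s -> between A.1 B.1 (q l).1 -> ~~ between X.1 Y.1 (q l).1 ->
    (size [seq i <- s | between X.1 Y.1 (q i).1] < n)%N.
  move=> sub sl hl nl; apply: leq_trans (_ : (size [seq i <- s | between A.1 B.1 (q i).1] <= n)%N).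
    apply: (@uniq_leq_size _ (l :: [seq i <- s | between X.1 Y.1 (q i).1])).
      by rewrite /= mem_filter (negbTE nl) /= filter_uniq ?s_uniq.
    move=> m; rewrite inE => /orP[/eqP->|]; first by rewrite mem_filter hl.
    by rewrite !mem_filter => /andP[/sub -> ->].
  exact: le_n.
have xk : (q k).1 < x by rewrite /x; lra.
have [AMlt MBlt] : (size [seq i <- s | between A.1 M.1 (q i).1] < n)%N /\
    (size [seq i <- s | between M.1 B.1 (q i).1] < n)%N.
  rewrite /M /=; case: (ltgtP A.1 B.1) ABn x_in => // lAB _ /andP[Ax xB].
    split; [apply: (small A M k' _ sk' hk') | apply: (small M B k _ sk hk)];
      rewrite /= ?between_lt //.
    + by move=> m; rewrite !between_lt //= => /andP[-> /le_trans->] //; exact: ltW.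
    + by rewrite negb_and -!ltNge [x < _]kk' orbT.
    + by move=> m; rewrite !between_lt //= => /andP[/(le_trans (ltW Ax))-> ->].
    + by rewrite negb_and -!ltNge xk.
  split; [apply: (small A M k _ sk hk) | apply: (small M B k' _ sk' hk')];
    rewrite /= ?between_gt //.
  + by move=> m; rewrite !between_gt //= => /andP[/(le_trans (ltW Ax))-> ->].
  + by rewrite negb_and -!ltNge xk.
  + by move=> m; rewrite !between_gt //= => /andP[-> /le_trans->] //; exact: ltW.
  + by rewrite negb_and -!ltNge [x < _]kk' orbT.
have AM := IHn A M AMlt gA gM (subAM _ _ (@segment_l _ A B) sM).
have MB := IHn M B MBlt gM gB (subAM _ _ sM (@segment_r _ A B)).
have tri : (triangle A M B `<=` N)%classic.
  move=> X hX; move/asboolP: AB; apply; move: hX.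
  by apply: segment_convex => //; [exact: segment_l | exact: segment_r].
have triC : (triangle B M A `<=` N)%classic.
  move=> X [a [b [c [a0 b0 c0 abc ->]]]]; apply: tri; exists c, b, a; split=> //.
    by rewrite addrC [c + b]addrC addrA.
  by rewrite [RHS]addrC [c *: _ + _]addrC addrA.
(* For an edge running leftward the reversed edge is split and the result inverted. *)
have -> : edge_word q s A B = edge_word q s A M ++ edge_word q s M B.
  case: (ltgtP A.1 B.1) ABn x_in => // lAB _ /andP[? ?].
    by rewrite (edge_word_split s_sorted tri) //; right; apply/lexltP; left.
  rewrite -edge_word_inv -(edge_word_split s_sorted triC);
    [|by right; apply/lexltP; left..].
  by rewrite inv_word_cat !edge_word_inv.
rewrite word_path_cat.
apply: (@path_homotopic_trans _ _ _ [:: low A.1; A; M; B]).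
  apply: (@path_homotopic_convex _ _ (segment A B) _ [:: low A.1; A] [::] [:: M]).
  - exact: segment_convex.
  - exact/asboolP.
  - exact: segment_l.
  - exact: segment_r.
  - by each_vertex.
  - by each_vertex.
apply: path_homotopic_trans.
  exact: (@path_homotopic_cat _ N O [::] _ _ [:: B] AM).
rewrite -!catA /=.
have := @path_homotopic_cat _ N O (word_path (edge_word q s A M))
  [:: low M.1; M; B] (word_path (edge_word q s M B) ++ [:: low B.1; B]) [::].
by rewrite last_word_path !cats0; exact.
Qed.

(** The vertical lift from the base line travels along the path with the current vertex, while the
    loops of the edges already treated accumulate at the base point. *)
Lemma path_canonical A r :
  (forall X, X \in A :: r -> generic X) -> path (segment_in N) A r ->
  [:: low A.1, A & r] ~~>
  word_path (path_word q s A r) ++ [:: low (last A r).1; last A r].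
Proof.
elim: r A => [|B r IHr] A gA /=; first by move=> _; exact: path_homotopic_refl.
case/andP=> AB Br; rewrite path_word_cons word_path_cat.
apply: (@path_homotopic_trans _ _ _
    ((word_path (edge_word q s A B) ++ [:: low B.1; B]) ++ r)).
  apply: (@path_homotopic_cat _ N O [::] [:: low A.1; A; B] _ r).
  by apply: edge_canonical => //; apply: gA; rewrite !inE eqxx ?orbT.
rewrite -!catA.
have := @path_homotopic_cat _ N O (word_path (edge_word q s A B))
  [:: low B.1, B & r] _ [::] _.
rewrite last_word_path => /(_ _ (IHr B _ Br)); rewrite !cats0; apply.
by move=> X Xr; apply: gA; rewrite inE Xr orbT.
Qed.

Lemma segment_in_bottom A B : bottom A -> bottom B -> segment_in N A B.
Proof. exact: convex_segment_in (@halfplane_convex _ _ _ _) bottom_sub. Qed.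

Lemma segment_in_top A B : top A -> top B -> segment_in N A B.
Proof. exact: convex_segment_in (@halfplane_convex _ _ _ _) top_sub. Qed.

Lemma segment_in_strip u A B :
  free_strip u u -> A.1 = u -> B.1 = u -> segment_in N A B.
Proof.
move=> fr uA uB; apply: convex_segment_in (strip_convex (u := u) (v := u)) _ _ _.
- exact: strip_sub.
- exact: stripl.
- exact: stripl.
Qed.

(** The additional [O] gives the empty word a line with a vertex, since closed lines are
    nonempty. *)
Lemma line_canonical l :
  closed_line_in N l -> (forall X, X \in l -> generic X) ->
  homotopic N l (rcons (word_path (line_word q s l)) O).
Proof.
case: l => [|A t]; first by case.
move=> cl gl; have /closed_lineP[_ /= hp] := cl.
have gA : generic A by apply: gl; rewrite mem_head.
have frA := generic_free_strip gA.
have lastA : last A (rcons t A) = A by rewrite last_rcons.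
have edge_low : segment_in N A (low A.1) by exact: segment_in_strip frA _ _.
have low_edge : segment_in N (low A.1) A by exact: segment_in_strip frA _ _.
have low_O : segment_in N (low A.1) O.
  by apply: segment_in_bottom; exact: bottom_low.
have O_low : segment_in N O (low A.1).
  by apply: segment_in_bottom; exact: bottom_low.
(* A detour from [A] to the base point and back. It makes [O] a vertex, at which the line can then
   be opened. *)
pose tail := [:: low A.1; O; low A.1; A].
apply: (@homotopic_trans _ _ (rcons t A)).
  by apply: homotopic_same_cyclic cl _; rewrite -cats1; exact: (same_cyclic_cat [:: A]).
apply: (@homotopic_trans _ _ (rcons t A ++ tail)).
  apply: (path_homotopic_homotopic (A := A)) => //; last by case: (t).
  apply: (@path_homotopic_trans _ _ _ (t ++ [:: A; A])).
    rewrite -cats1; apply/path_homotopic_sym/path_homotopic_dup.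
    by move: hp; rewrite rcons_path => /andP[].
  rewrite -[t ++ _]cat_rcons /tail.
  apply: (@path_homotopic_trans _ _ _ (rcons t A ++ [:: low A.1; low A.1; A])).
    apply: (@path_homotopic_convex _ _ (strip A.1 A.1) _ (rcons t A) [::]
      [:: low A.1; low A.1] A [::]).
    - exact: strip_convex.
    - exact: strip_sub.
    - by rewrite lastA; exact: stripl.
    - exact: stripl.
    - by each_vertex.
    - by each_vertex; exact: stripl.
  rewrite -!(cat_rcons (low A.1) (rcons t A)).
  apply: (@path_homotopic_convex _ _ bottom _ (rcons (rcons t A) (low A.1)) [::]
    [:: O] (low A.1) [:: A]).
  - exact: halfplane_convex.
  - exact: bottom_sub.
  - by rewrite last_rcons; exact: bottom_low.
  - exact: bottom_low.
  - by each_vertex.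
  - by each_vertex; exact: bottom_low.
pose r := [:: low A.1, A & rcons t A] ++ [:: low A.1; O].
have cyc : same_cyclic (rcons t A ++ tail) r.
  rewrite /r /tail -(cat1s (low A.1) [:: O; _; _]) -(cat1s O).
  have -> : rcons t A ++ [:: low A.1] ++ [:: O] ++ [:: low A.1; A] =
    (rcons t A ++ [:: low A.1; O]) ++ [:: low A.1; A] by rewrite -catA.
  exact: same_cyclic_cat.
have hr : path (segment_in N) O r.
  by rewrite /r /= cat_path lastA /= O_low low_edge hp edge_low low_O.
have lr : last O r = O by rewrite /r /= last_cat.
apply: (@homotopic_trans _ _ r).
  apply: homotopic_same_cyclic (cyc).
  apply: closed_line_same_cyclic (same_cyclic_sym cyc) _.
  exact: closed_path_line lr.
apply: (path_homotopic_homotopic (A := O)) => //.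
rewrite /line_word; set w := path_word _ _ _ _.
apply: (@path_homotopic_trans _ _ _ (word_path w ++ [:: low A.1; A; low A.1; O])).
  have := @path_canonical A (rcons t A) _ hp; rewrite lastA => pc.
  have := @path_homotopic_cat _ N O [::] _ _ [:: low A.1; O] (pc _).
  rewrite /= -/w -catA; apply => X; rewrite inE mem_rcons => /orP[/eqP->|] //.
  exact: gl.
(* What remains besides the loops is the lift to [A] and back, which retracts along a vertical
   line. *)
apply: (@path_homotopic_trans _ _ _ (word_path w ++ [:: low A.1; low A.1; O])).
  rewrite -!(cat_rcons (low A.1) (word_path w)).
  apply: (@replace_strip A.1 A.1 _ [:: A] [::] _ [:: O]) => //.
  by each_vertex; left; rewrite ?last_rcons.
rewrite -cats1; apply: (@replace_bottom (word_path w) [:: low A.1; low A.1] [::] O [::]).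
by each_vertex; rewrite ?last_word_path; exact: bottom_low.
Qed.

(** * Canonical lines of conjugate words *)

Lemma free_strip_beside i u : i \in s -> u = (q i).1 + d \/ u = (q i).1 - d ->
  free_strip u u.
Proof.
have d0 := d_gt0; move=> si hu j sj; apply/negP; rewrite /between orbb.
have [->|ji] := eqVneq j i; first by move=> /andP[? ?]; lra.
by have := gap sj si ji; case: (lerP (q j).1 (q i).1) => ? ? /andP[? ?]; lra.
Qed.

Lemma handle_path u v : free_strip u u -> free_strip v v ->
  path (segment_in N) O (handle u v).
Proof.
move=> fu fv; apply/and5P; split; rewrite ?andbT.
- by apply: segment_in_bottom; exact: bottom_low.
- exact: segment_in_strip fu _ _.
- by apply: segment_in_top; exact: top_high.
- exact: segment_in_strip fv _ _.
- by apply: segment_in_bottom; exact: bottom_low.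
Qed.

Lemma loop_path (x : bool * nat) : path (segment_in N) O (loop x).
Proof.
case: x => b i; rewrite /loop /=; case: ifP => si; last first.
  by rewrite /= andbT; apply: segment_in_bottom; exact: bottom_low.
by case: b; apply: handle_path; apply: free_strip_beside si _; [right|left|left|right].
Qed.

Lemma word_path_path w : path (segment_in N) O (word_path w).
Proof.
elim: w => // x w IHw; rewrite /word_path /= cat_path loop_path.
by rewrite last_loop -/(word_path w) IHw.
Qed.

Lemma word_line_path w : path (segment_in N) O (rcons (word_path w) O).
Proof.
rewrite rcons_path word_path_path last_word_path.
by apply: segment_in_bottom; exact: bottom_low.
Qed.

Lemma word_line_closed w : closed_line_in N (rcons (word_path w) O).
Proof.
apply: (closed_path_line (A := O)) (word_line_path w) _.
  by rewrite -size_eq0 size_rcons.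
exact: last_rcons.
Qed.

(** Rotating a word rotates the list of its loops only once the extra final [O] has been removed. *)
Lemma word_line_base w : w != [::] ->
  homotopic N (rcons (word_path w) O) (word_path w).
Proof.
case/lastP: w => // w x _; have := word_line_path (rcons w x).
have [r ->] : exists r, word_path (rcons w x) = rcons r O.
  rewrite -cats1 word_path_cat /word_path /= cats0.
  rewrite /loop; case: ifP => _; last by exists (word_path w); rewrite cats1.
  by case: ifP => _; eexists (_ ++ [:: _; _; _; _]); rewrite -cats1 -catA.
move=> hp; apply: (path_homotopic_homotopic (A := O)) (hp) _.
- rewrite -!cats1 -catA; apply: path_homotopic_dup.
  by move: hp; rewrite !rcons_path => /andP[/andP[]].
- by rewrite -size_eq0 size_rcons.
- exact: last_rcons.
Qed.

(** The second handle retraces the first backwards, so the path contracts from its middle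
    outwards. *)
Lemma handle_cancel u v C r : bottom C -> free_strip u u -> free_strip v v ->
  handle u v ++ handle v u ++ C :: r ~~> C :: r.
Proof.
move=> bC fu fv; rewrite /handle /=.
apply: path_homotopic_trans.
  apply: (@replace_bottom [:: low u; high u; high v; low v] [:: O] [::] (low v)).
  by each_vertex; exact: bottom_low.
apply: path_homotopic_trans.
  apply: (@replace_strip v v [:: low u; high u; high v] [:: low v; low v] [::]
    (high v)) => //.
  by each_vertex; left.
apply: path_homotopic_trans.
  apply: (@replace_top [:: low u; high u] [:: high v; high v] [::] (high u)).
  by each_vertex; exact: top_high.
apply: path_homotopic_trans.
  apply: (@replace_strip u u [:: low u] [:: high u; high u] [::] (low u)) => //.
  by each_vertex; left.
apply: (@replace_bottom [::] [:: low u; low u; O] [::] C).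
by each_vertex => //; exact: bottom_low.
Qed.

Lemma loop_cancel (x : bool * nat) C r : bottom C ->
  loop x ++ loop (flip x) ++ C :: r ~~> C :: r.
Proof.
case: x => b i bC; rewrite /loop /flip /=; case: ifP => si.
  by case: b; apply: handle_cancel => //; apply: free_strip_beside si _;
    [right|left|left|right].
(* [conjugate] may insert letters that name no puncture of [s]; their loops are constant. *)
apply: (@replace_bottom [::] [:: O; O] [::] C).
by each_vertex => //; exact: bottom_low.
Qed.

Lemma conjugate_homotopic w w' : conjugate flip w w' ->
  homotopic N (rcons (word_path w) O) (rcons (word_path w') O).
Proof.
elim=> {w w'} [w|u v _|v u w _ IH1 _ IH2|u v|x w].
- exact/homotopic_refl/word_line_closed.
- exact: homotopic_sym.
- exact: homotopic_trans IH1 IH2.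
- have [e|uv] := eqVneq (u ++ v) [::].
    by case: u v e => // -[] // _; exact/homotopic_refl/word_line_closed.
  have vu : v ++ u != [::].
    by apply: contra uv; rewrite -!size_eq0 !size_cat addnC.
  apply: homotopic_trans (word_line_base uv) _.
  apply: homotopic_trans; last exact/homotopic_sym/word_line_base.
  rewrite !word_path_cat; apply: homotopic_same_cyclic (same_cyclic_cat _ _).
  rewrite -word_path_cat; apply: (closed_path_line (A := O)).
  + apply: contra uv; case: (u ++ v) => // x w.
    by rewrite /word_path /= /loop; case: ifP => // _; case: ifP.
  + exact: word_path_path.
  + exact: last_word_path.
(* The last contraction keeps the vertex after the cancelled loops, which must exist and lie on the
   base line. *)
have [C [r [bC er]]] : exists C r, bottom C /\ rcons (word_path w) O = C :: r.
  case: w => [|y w]; first by exists O, [::]; split=> //; exact: bottom_low.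
  by rewrite /word_path /= /loop; case: ifP => _; [case: ifP => _|];
    do 2 eexists; split; try (by []); exact: bottom_low.
apply: (path_homotopic_homotopic (A := O)); last 3 first.
- by rewrite -size_eq0 size_rcons.
- exact: word_line_path.
- exact: last_rcons.
rewrite {1}/word_path /= -/(word_path w) -!cats1 -!catA cats1 er.
exact: loop_cancel.
Qed.

Lemma conjugate_word_homotopic l l' :
  closed_line_in N l -> closed_line_in N l' ->
  (forall X, X \in l ++ l' -> generic X) ->
  conjugate flip (line_word q s l) (line_word q s l') -> homotopic N l l'.
Proof.
move=> cl cl' g ll'; apply: homotopic_trans (line_canonical cl _) _.
  by move=> X Xl; apply: g; rewrite mem_cat Xl.
apply: homotopic_trans (conjugate_homotopic ll') _.
apply/homotopic_sym/line_canonical => // X Xl.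
by apply: g; rewrite mem_cat Xl orbT.
Qed.

End CanonicalLines.

(** * Shearing away vertical coincidences *)

Section Shear.
Variable R : realType.
Implicit Types (A B C X : plane R) (e : R) (l : seq (plane R)).

Definition shear e A : plane R := (A.1 + e * A.2, A.2).

Lemma shearK e : cancel (shear e) (shear (- e)).
Proof. by move=> A; apply: plane_eq => //=; ring. Qed.

Lemma shearNK e : cancel (shear (- e)) (shear e).
Proof. by move=> A; apply: plane_eq => //=; ring. Qed.

Lemma triangle_shear e A B C X :
  triangle (shear e A) (shear e B) (shear e C) X -> triangle A B C (shear (- e) X).
Proof.
move=> [a [b [c [a0 b0 c0 abc ->]]]]; exists a, b, c; split=> //.
by apply: plane_eq => //; rewrite /= /GRing.scale /=; ring.
Qed.

Lemma segment_shear e A B X :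
  segment (shear e A) (shear e B) X -> segment A B (shear (- e) X).
Proof.
move=> [a [b [a0 b0 ab ->]]]; exists a, b; split=> //.
by apply: plane_eq => //; rewrite /= /GRing.scale /=; ring.
Qed.

Section Sets.
Variables (e : R) (N N' : set (plane R)).
Hypothesis NN' : forall X, N X -> N' (shear e X).

Lemma closed_line_shear l : closed_line_in N l -> closed_line_in N' (map (shear e) l).
Proof.
case: l => [|A t]; first by case.
move=> /closed_lineP[_ hp]; apply/closed_lineP; split=> //.
move: hp; rewrite /= -map_rcons path_map; apply: sub_path => X Y /asboolP XY.
by apply/asboolP => Z /segment_shear/XY/NN'; rewrite shearNK.
Qed.

Lemma elementary_cancellation_shear l l' :
  elementary_cancellation N l l' ->
  elementary_cancellation N' (map (shear e) l) (map (shear e) l').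
Proof.
move=> [B [C [r [hl tri hl']]]].
exists (shear e B), (shear e C), (map (shear e) r); split.
- exact: (same_cyclic_map _ hl).
- move=> X; rewrite last_map => /triangle_shear/tri/NN'.
  by rewrite shearNK.
- exact: (same_cyclic_map _ hl').
Qed.

Lemma homotopic_shear l l' :
  homotopic N l l' -> homotopic N' (map (shear e) l) (map (shear e) l').
Proof.
move=> [k [L [L0 Lk clL stL]]]; exists k, (fun i => map (shear e) (L i)); split.
- exact: same_cyclic_map.
- exact: same_cyclic_map.
- by move=> i /clL; exact: closed_line_shear.
by move=> i /stL[|] ?; [left|right]; exact: elementary_cancellation_shear.
Qed.

End Sets.

(** A shear has determinant 1. *)
Lemma area_shear e A B X : area (shear e A) (shear e B) (shear e X) = area A B X.
Proof. by rewrite /area /=; ring. Qed.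

Lemma exists_lower_bound (s : seq R) : (forall x, x \in s -> 0 < x) ->
  exists2 d, 0 < d & forall x, x \in s -> d < x.
Proof.
elim: s => [|x s IHs] hs; first by exists 1.
have [y ys|d d0 hd] := IHs; first by apply: hs; rewrite inE ys orbT.
have x0 : 0 < x by apply: hs; rewrite mem_head.
exists (Num.min d (x / 2)); first by rewrite lt_min d0 divr_gt0.
move=> y; rewrite inE gt_min => /orP[/eqP->|/hd->//].
by rewrite ltr_pdivrMr // mulr_natr mulr2n ltrDl x0 orbT.
Qed.

Lemma exists_upper_bound (s : seq R) :
  exists h, forall x, x \in s -> - h < x < h.
Proof.
elim: s => [|x s [h hs]]; first by exists 0.
exists (Num.max h (`|x| + 1)) => y; rewrite inE => /orP[/eqP->|/hs].
  have h1 : `|x| < Num.max h (`|x| + 1) by rewrite lt_max ltrDl ltr01 orbT.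
  by rewrite -ltr_norml.
move=> /andP[h1 h2]; have hm : h <= Num.max h (`|x| + 1) by rewrite le_max lexx.
by apply/andP; split; lra.
Qed.

Variables (q : nat -> plane R) (s : seq nat).
Hypothesis s_sorted : sorted (fun i j => lexlt (q i) (q j)) s.

Section ShearWord.
Variables (e : R) (pts : seq (plane R)).
Hypothesis lexlt_e : {in pts &, forall A B, lexlt (shear e A) (shear e B) = lexlt A B}.
Hypothesis q_pts : forall i, i \in s -> q i \in pts.
Local Notation q' := (fun i => shear e (q i)).

(** Crossings depend only on the lexicographic order and on areas, both preserved on [pts]. *)
Lemma edge_word_shear A B : A \in pts -> B \in pts ->
  edge_word q' s (shear e A) (shear e B) = edge_word q s A B.
Proof.
have cr X Y i : X \in pts -> Y \in pts -> i \in s ->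
    crosses (shear e X) (shear e Y) (q' i) = crosses X Y (q i).
  by move=> hX hY /q_pts hi; rewrite /crosses area_shear !lexlt_e.
move=> hA hB; rewrite /edge_word; congr cat; congr map.
  by apply: eq_in_filter => i; exact: cr.
by apply: eq_in_filter => i; rewrite mem_rev; exact: cr.
Qed.

Lemma line_word_shear l : {subset l <= pts} ->
  line_word q' s (map (shear e) l) = line_word q s l.
Proof.
case: l => // A t sub; rewrite /= -map_rcons.
have : {subset A :: rcons t A <= pts}.
  by move=> X; rewrite inE mem_rcons => /orP[/eqP->|/sub//]; exact/sub/mem_head.
move: (rcons t A) => r; elim: r {t sub} A => // B r IHr A sub.
rewrite /= !path_word_cons edge_word_shear; last 2 first.
- by apply: sub; rewrite mem_head.
- by apply: sub; rewrite !inE eqxx orbT.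
by rewrite IHr // => X Xr; apply: sub; rewrite inE Xr orbT.
Qed.

Lemma sorted_shear : sorted (fun i j => lexlt (q' i) (q' j)) s.
Proof.
rewrite -(@eq_in_sorted _ (mem s) (fun i j => lexlt (q i) (q j))) //.
by move=> i j /q_pts hi /q_pts hj; rewrite lexlt_e.
Qed.

End ShearWord.

Lemma lexlt_shear_pts (pts : seq (plane R)) :
  exists e, {in pts &, forall A B, lexlt A B = ((shear e A).1 < (shear e B).1)}.
Proof.
have [e _ he] := lexlt_shear [seq (A, B) | A <- pts, B <- pts].
exists e => A B hA hB.
have le X Y : X \in pts -> Y \in pts -> lexlt X Y -> (shear e X).1 < (shear e Y).1.
  by move=> hX hY; apply: he; exact: allpairs_f.
case: (lexlt_total A B) => [->|AB|BA]; first by rewrite lexlt_irr ltxx.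
  by rewrite AB le.
by rewrite (lexlt_asym BA) lt_gtF // le.
Qed.

(** Invariance of the word needs no generic position. For the converse, a small shear separates the
    abscissas of distinct points without changing the words; the homotopy found there is sheared
    back. *)
Theorem homotopic_conjugate l l' :
  closed_line_in (punctured q s) l -> closed_line_in (punctured q s) l' ->
  homotopic (punctured q s) l l' <->
  conjugate flip (line_word q s l) (line_word q s l').
Proof.
move=> cl cl'; split; first exact: homotopic_word.
move=> ll'; pose pts := l ++ l' ++ map q s.
have [e he] := lexlt_shear_pts pts.
have q_pts i : i \in s -> q i \in pts.
  by move=> si; rewrite !mem_cat map_f ?orbT.
have l_pts : {subset l <= pts} by move=> X Xl; rewrite mem_cat Xl.
have l'_pts : {subset l' <= pts} by move=> X Xl; rewrite !mem_cat Xl orbT.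
have lexlt_e : {in pts &, forall A B, lexlt (shear e A) (shear e B) = lexlt A B}.
  move=> A B hA hB; case: (lexlt_total A B) => [->|AB|BA].
  - by rewrite !lexlt_irr.
  - by rewrite AB; apply/lexltP; left; rewrite -he.
  - by rewrite (lexlt_asym BA) lexlt_asym //; apply/lexltP; left; rewrite -he.
pose q' i := shear e (q i).
have sub : forall X, punctured q s X -> punctured q' s (shear e X).
  by move=> X hX i /hX hi /(can_inj (shearK e)).
have sub' : forall X, punctured q' s X -> punctured q s (shear (- e) X).
  by move=> X hX i /hX hi eX; apply: hi; rewrite /q' -eX shearNK.
have shear_neq A B : A \in pts -> B \in pts -> A <> B ->
    (shear e A).1 != (shear e B).1.
  move=> hA hB AB; case: (lexlt_total A B) => // h.
    by rewrite lt_eqF // -he.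
  by rewrite gt_eqF // -he.
(* Strict sortedness makes [q] injective on [s]. *)
have q_neq i j : i \in s -> j \in s -> i != j -> (q' i).1 != (q' j).1.
  move=> si sj ij; apply: shear_neq; rewrite ?q_pts // => eq.
  have lt := @sorted_ltn_index _ (fun i j => lexlt (q i) (q j))
    (fun j i k => @lexlt_trans R (q j) (q i) (q k)) s s_sorted.
  have : index i s != index j s 
    by apply: contra ij => /eqP ei; rewrite -(nth_index 0%N si) ei nth_index.
  rewrite neq_ltn => /orP[/lt|/lt]; rewrite eq lexlt_irr.
    by move=> /(_ si sj).
  by move=> /(_ sj si).
have [d d0 hd] : exists2 d, 0 < d & forall x,
    x \in [seq `|(q' ij.1).1 - (q' ij.2).1| |
      ij <- [seq (i, j) | i <- s, j <- s] & ij.1 != ij.2] -> d < x.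
  apply: exists_lower_bound => x /mapP[[i j]].
  rewrite mem_filter => /andP[/= ij /allpairsP[[i' j'] [/= si sj [ei ej]]]] ->.
  by rewrite normr_gt0 subr_eq0 q_neq // ?ei ?ej.
have [h hh] := exists_upper_bound [seq X.2 | X <- map (shear e) pts].
have gap i j : i \in s -> j \in s -> i != j -> d < `|(q' i).1 - (q' j).1|.
  move=> si sj ij; apply: hd; apply/mapP; exists (i, j) => //.
  by rewrite mem_filter ij; apply: allpairs_f.
have height i : i \in s -> - h < (q' i).2 < h.
  by move=> /q_pts si; apply: hh; rewrite -map_comp; apply/mapP; exists (q i).
have lc := closed_line_shear sub cl; have lc' := closed_line_shear sub cl'.
have hom : homotopic (punctured q' s) (map (shear e) l) (map (shear e) l').
  apply: (conjugate_word_homotopic (sorted_shear lexlt_e q_pts) d0 gap height) => //.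
    move=> Y; rewrite -map_cat => /mapP[X Xll ->].
    have X_pts : X \in pts by rewrite /pts catA mem_cat Xll.
    split.
      move=> i si; apply: shear_neq; rewrite ?q_pts // => eX.
      by move: Xll; rewrite mem_cat => /orP[] /(closed_line_vertex _) XN;
        [case: (XN _ cl i si) | case: (XN _ cl' i si)].
    have /andP[? ?] : - h < (shear e X).2 < h.
      by apply: hh; rewrite -map_comp; apply/mapP; exists X.
    by apply/andP; split; exact: ltW.
  by rewrite !(line_word_shear lexlt_e q_pts).
have := homotopic_shear sub' hom.
by rewrite !(mapK (shearK e)).
Qed.

End Shear.

(** * Programs *)

Section TotalCorrectness.
Variable R : realType.
Implicit Types (s : state R) (P : program) (Q : state R -> Prop).

Definition ensures P s Q := exists2 s', exec P s s' & Q s'.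

Lemma ensures_imp P s Q Q' :
  ensures P s Q -> (forall s', Q s' -> Q' s') -> ensures P s Q'.
Proof. by move=> [s' hs' q] h; exists s'; [|exact: h]. Qed.

Lemma ensures_skip s Q : Q s -> ensures Skip s Q.
Proof. by move=> q; exists s; [exact: ExecSkip|]. Qed.

Lemma ensures_nset a e v s Q :
  Q (State (update (nmem s) a (neval s e) (neval s v)) (rmem s)) ->
  ensures (Nset a e v) s Q.
Proof. by move=> q; eexists; [exact: ExecNset|]. Qed.

Lemma ensures_rset a e v s Q :
  Q (State (nmem s) (update (rmem s) a (neval s e) (reval s v))) ->
  ensures (Rset a e v) s Q.
Proof. by move=> q; eexists; [exact: ExecRset|]. Qed.

Lemma ensures_seq P P' s Q :
  ensures P s (fun s' => ensures P' s' Q) -> ensures (Seq P P') s Q.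
Proof. by move=> [s1 h1 [s2 h2 q]]; exists s2; [exact: ExecSeq h1 h2|]. Qed.

Lemma ensures_if b P P' s Q :
  (beval s b -> ensures P s Q) -> (~~ beval s b -> ensures P' s Q) ->
  ensures (If b P P') s Q.
Proof.
move=> h1 h2; have [hb|hb] := boolP (beval s b).
  by have [s' e q] := h1 hb; exists s'; [exact: ExecIfTrue|].
by have [s' e q] := h2 hb; exists s'; [exact: ExecIfFalse|].
Qed.

Lemma ensures_while (I : state R -> Prop) (m : state R -> nat) b P s Q :
  I s ->
  (forall s, I s -> beval s b -> ensures P s (fun s' => I s' /\ (m s' < m s)%N)) ->
  (forall s, I s -> ~~ beval s b -> Q s) ->
  ensures (While b P) s Q.
Proof.
move=> Is step done_; have [n] := ubnP (m s).
elim: n s Is => // n IHn s Is /ltnSE le_n.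
have [hb|hb] := boolP (beval s b); last first.
  by exists s; [exact: ExecWhileFalse | exact: done_].
have [s1 e1 [Is1 lt1]] := step s Is hb.
have [s2 e2 q] := IHn s1 Is1 (leq_trans lt1 le_n).
by exists s2; [exact: ExecWhileTrue hb e1 e2|].
Qed.

End TotalCorrectness.

(** * Geometric tests as program expressions *)

Definition Nvar a := Nget a (Nconst 0).
Definition Neq e1 e2 := Band (Nle e1 e2) (Nle e2 e1).
Definition Nlt e1 e2 := Bnot (Nle e2 e1).
Definition Rlt e1 e2 := Bnot (Rle e2 e1).
Definition Req e1 e2 := Band (Rle e1 e2) (Rle e2 e1).
Definition Bor b1 b2 := Bnot (Band (Bnot b1) (Bnot b2)).
Definition Rsub e1 e2 := Radd e1 (Ropp e2).

Section PointTests.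
Implicit Types A B X : (rexp * rexp)%type.

Definition Blexlt A B :=
  Bor (Rlt A.1 B.1) (Band (Req A.1 B.1) (Rlt A.2 B.2)).

Definition Rarea A B X :=
  Rsub (Rmul (Rsub B.1 A.1) (Rsub X.2 A.2)) (Rmul (Rsub B.2 A.2) (Rsub X.1 A.1)).

Definition Bcrosses A B X :=
  Band (Blexlt A X) (Band (Blexlt X B) (Rlt (Rarea A B X) (Rconst 0))).

Variables (R : realType) (s : state R).

Definition point_eval A : plane R := (reval s A.1, reval s A.2).

Lemma Neq_eval e1 e2 : beval s (Neq e1 e2) = (neval s e1 == neval s e2).
Proof. by rewrite /= eqn_leq. Qed.

Lemma Nlt_eval e1 e2 : beval s (Nlt e1 e2) = (neval s e1 < neval s e2)%N.
Proof. by rewrite /= ltnNge. Qed.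

Lemma Blexlt_eval A B :
  beval s (Blexlt A B) = lexlt (point_eval A) (point_eval B).
Proof. by rewrite /lexlt /= negb_and !negbK eq_le -!ltNge. Qed.

Lemma Bcrosses_eval A B X :
  beval s (Bcrosses A B X) = crosses (point_eval A) (point_eval B) (point_eval X).
Proof.
rewrite -[LHS]/(beval s (Blexlt A X) && (beval s (Blexlt X B) && _)).
by rewrite !Blexlt_eval /crosses /= -ltNge.
Qed.

End PointTests.

(** * Free and cyclic reduction with a stack *)

Definition code (x : bool * nat) : nat := (x.2.*2 + x.1)%N.

Lemma code_inj : injective code.
Proof.
move=> [b i] [b' i'] /= e; have eb : b = b'.
  by have := congr1 odd e; rewrite /code !oddD !odd_double !oddb.
by rewrite eb in e *; congr pair; move/addIn: e; exact: double_inj.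
Qed.

Definition stack_push (st : seq (bool * nat)) x :=
  if (st != [::]) && (last x st == flip x) then take (size st).-1 st
  else rcons st x.

Notation reduced := (sorted (noninverse flip)).

Lemma stack_push_rcons st y x :
  stack_push (rcons st y) x = if y == flip x then st else rcons (rcons st y) x.
Proof.
rewrite /stack_push -size_eq0 size_rcons last_rcons /=.
by rewrite -cats1 take_size_cat.
Qed.

Lemma stack_push_reduced st x : reduced st -> reduced (stack_push st x).
Proof.
case/lastP: st => // st y; rewrite stack_push_rcons => h.
case: ifP => [_|/negbT xy].
  by move: h; rewrite -cats1; case: st => //= z st; rewrite cat_path => /andP[].
have yx : noninverse flip y x.
  by apply: contraNneq xy => ->; rewrite flipK.
case: st h => [|z st] /=; first by rewrite yx.
by rewrite !rcons_path last_rcons yx => ->.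
Qed.

Lemma stack_push_free_eq st x : free_eq flip (stack_push st x) (rcons st x).
Proof.
case/lastP: st => [|st y]; first exact: free_eq_refl.
rewrite stack_push_rcons.
case: eqP => [->|_]; last exact: free_eq_refl.
rewrite -2!cats1 -catA -{1}[st]cats0; apply: free_eq_cat; first exact: free_eq_refl.
apply/free_eq_sym => w /=; rewrite -{2}[x]flipK; exact: conjugate_cancel.
Qed.

Lemma foldl_stack_push st t :
  reduced st -> reduced (foldl stack_push st t) /\
  free_eq flip (foldl stack_push st t) (st ++ t).
Proof.
elim: t st => [|x t IHt] st hst; first by rewrite cats0; split=> //; exact: free_eq_refl.
have [h1 h2] := IHt _ (stack_push_reduced x hst); split=> //=.
apply: free_eq_trans h2 _; rewrite -cat_rcons.
by apply: free_eq_cat (stack_push_free_eq _ _) _; exact: free_eq_refl.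
Qed.

(* The arrays used for the first line (j = false) and for the second one.  The
   code of the inverse of each letter is stored next to that of the letter,
   because natural expressions cannot compute the one from the other. *)
Definition stack_of (j : bool) : nat := if j then 6%N else 1%N.
Definition inverses_of (j : bool) : nat := if j then 7%N else 2%N.
Definition top_of (j : bool) : nat := if j then 8%N else 3%N.
Definition bottom_of (j : bool) : nat := if j then 9%N else 4%N.
Definition index_of (j : bool) : nat := if j then 10%N else 5%N.
Definition length_of (j : bool) := Nget 0 (Nconst (if j then 2%N else 1%N)).
Definition xs_of (j : bool) : nat := if j then 4%N else 2%N.
Definition ys_of (j : bool) : nat := if j then 5%N else 3%N.

Section Update.
Variables (T : Type) (m : nat -> nat -> T) (a i : nat) (v : T).

Lemma update_same : update m a i v a i = v.
Proof. by rewrite /update !eqxx. Qed.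

Lemma update_array b k : b != a -> update m a i v b k = m b k.
Proof. by rewrite /update => /negbTE->. Qed.

Lemma update_cell b k : k != i -> update m a i v b k = m b k.
Proof. by rewrite /update => /negbTE->; rewrite andbF. Qed.

End Update.

Definition holds (T : Type) (m : nat -> T) (lo : nat) (w : seq T) :=
  forall k x0, (k < size w)%N -> m (lo + k)%N = nth x0 w k.

Lemma holds_rcons (T : Type) (m m' : nat -> T) lo w x :
  holds m lo w -> (forall i, i != lo + size w -> m' i = m i)%N ->
  m' (lo + size w)%N = x -> holds m' lo (rcons w x).
Proof.
move=> hw hm hx k x0; rewrite size_rcons nth_rcons ltnS leq_eqVlt.
move=> /orP[/eqP->|lt]; first by rewrite ltnn eqxx.
by rewrite lt hm ?(hw _ x0) // eqn_add2l neq_ltn lt.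
Qed.

Lemma holds_prefix (T : Type) (m : nat -> T) lo w w' :
  holds m lo (w ++ w') -> holds m lo w.
Proof.
move=> h k x0 hk; rewrite (h k x0) ?nth_cat ?hk //.
by rewrite size_cat; apply: leq_trans hk _; exact: leq_addr.
Qed.

Lemma holds_behead (T : Type) (m : nat -> T) lo x w :
  holds m lo (x :: w) -> holds m lo.+1 w.
Proof. by move=> h k x0 hk; rewrite addSnnS (h k.+1 x0). Qed.

Lemma holds_eq (T : Type) (m m' : nat -> T) lo w :
  m' =1 m -> holds m lo w -> holds m' lo w.
Proof. by move=> e h k x0 hk; rewrite e (h k x0). Qed.

Section StackPrograms.
Variable R : realType.
Implicit Types (s : state R) (j : bool) (w : seq (bool * nat)).

(** The word occupies the cells from the bottom, included, to the top, excluded, so letters are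
    removed at either end by moving a bound. *)
Definition stores s j lo w :=
  [/\ nmem s (bottom_of j) 0 = lo, nmem s (top_of j) 0 = (lo + size w)%N,
      holds (nmem s (stack_of j)) lo (map code w) &
      holds (nmem s (inverses_of j)) lo (map (code \o flip) w)].

Definition stack_frame j s s' := rmem s' = rmem s /\
  forall a i, a \notin [:: stack_of j; inverses_of j; top_of j; bottom_of j] ->
    nmem s' a i = nmem s a i.

Lemma stack_frame_refl j s : stack_frame j s s.
Proof. by []. Qed.

Lemma stack_frame_trans j s1 s2 s3 :
  stack_frame j s1 s2 -> stack_frame j s2 s3 -> stack_frame j s1 s3.
Proof.
move=> [r12 n12] [r23 n23]; split; first by rewrite r23.
by move=> a i ha; rewrite n23 // n12.
Qed.

(** [x] is fixed in the program text, so its code and that of its inverse are constants. The test on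
    the top comes with the truncated subtraction, which would read cell 0 of an empty stack. *)
Definition push j x :=
  If (Band (Nle (Nconst 1) (Nvar (top_of j)))
        (Neq (Nget (stack_of j) (Nsub (Nvar (top_of j)) (Nconst 1)))
           (Nconst (code (flip x)))))
    (Nset (top_of j) (Nconst 0) (Nsub (Nvar (top_of j)) (Nconst 1)))
    (Seq (Nset (stack_of j) (Nvar (top_of j)) (Nconst (code x)))
    (Seq (Nset (inverses_of j) (Nvar (top_of j)) (Nconst (code (flip x))))
         (Nset (top_of j) (Nconst 0) (Nadd (Nvar (top_of j)) (Nconst 1))))).

Lemma push_spec j x s w : stores s j 0 w ->
  ensures (push j x) s (fun s' => stores s' j 0 (stack_push w x) /\ stack_frame j s s').
Proof.
move=> [hb ht hV hW]; rewrite add0n in ht.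
have test : beval s (Band (Nle (Nconst 1) (Nvar (top_of j)))
        (Neq (Nget (stack_of j) (Nsub (Nvar (top_of j)) (Nconst 1)))
           (Nconst (code (flip x))))) = (w != [::]) && (last x w == flip x).
  rewrite -[LHS]/(_ && beval s (Neq _ _)) Neq_eval /= ht.
  case/lastP: w {hb ht hW} hV => // w y hV.
  rewrite size_rcons /= subn1 /= -size_eq0 size_rcons last_rcons /=.
  rewrite -[size w in LHS]add0n (hV _ 0%N) ?size_map ?size_rcons // map_rcons.
  by rewrite nth_rcons size_map ltnn eqxx (inj_eq code_inj).
apply: ensures_if; rewrite test => hx; rewrite /stack_push.
  rewrite hx; case/lastP: w hx hb ht hV hW {test} => // w y _ hb ht hV hW.
  rewrite size_rcons /= -cats1 take_size_cat //.
  rewrite -cats1 !map_cat in hV hW.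
  apply: ensures_nset; split; [split|split] => //=.
  - by case: (j) hb.
  - by rewrite update_same ht size_rcons subn1.
  - by apply: holds_eq (holds_prefix hV) => i; case: (j).
  - by apply: holds_eq (holds_prefix hW) => i; case: (j).
  - by move=> a i; rewrite !inE !negb_or => /and4P[_ _ ha _]; rewrite update_array.
rewrite (negbTE hx); apply: ensures_seq; apply: ensures_nset.
apply: ensures_seq; apply: ensures_nset; apply: ensures_nset.
split; [split|split] => //=.
- by case: (j) hb.
- by case: (j) ht; rewrite /update /= => ->; rewrite size_rcons addn1.
- rewrite map_rcons; apply: (holds_rcons hV); rewrite size_map add0n.
    by move=> i /negbTE hi; case: (j) ht; rewrite /update /= => ->; rewrite hi.
  by case: (j) ht; rewrite /update /= => ->; rewrite eqxx.
- rewrite map_rcons; apply: (holds_rcons hW); rewrite size_map add0n.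
    by move=> i /negbTE hi; case: (j) ht; rewrite /update /= => ->; rewrite hi.
  by case: (j) ht; rewrite /update /= => ->; rewrite eqxx.
move=> a i; rewrite !inE !negb_or => /and4P[h1 h2 h3 _].
by rewrite !update_array.
Qed.

(** An unrolled loop: the letters that may occur depend on the punctures only, hence are known in
    advance. *)
Fixpoint push_all j (c : bool * nat -> bexp) w :=
  if w is x :: w' then Seq (If (c x) (push j x) Skip) (push_all j c w') else Skip.

Lemma push_all_spec j c (f : pred (bool * nat)) t s w : stores s j 0 w ->
  (forall x s', x \in t -> stack_frame j s s' -> beval s' (c x) = f x) ->
  ensures (push_all j c t) s (fun s' =>
    stores s' j 0 (foldl stack_push w (filter f t)) /\ stack_frame j s s').
Proof.
elim: t s w => [|x t IHt] s w hw hc /=.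
  by apply: ensures_skip; split.
have hx := hc x s (mem_head _ _) (stack_frame_refl j s).
apply: ensures_seq; apply: (@ensures_imp _ _ _ (fun s' =>
    stores s' j 0 (if f x then stack_push w x else w) /\ stack_frame j s s')).
  apply: ensures_if; rewrite hx => fx; first by rewrite fx; exact: push_spec.
  by rewrite (negbTE fx); apply: ensures_skip.
move=> s1 [h1 fr1]; apply: ensures_imp (IHt _ _ h1 _) _.
  move=> y s' yt fr'; apply: hc; first by rewrite inE yt orbT.
  exact: stack_frame_trans fr1 fr'.
move=> s2 [h2 fr2]; split; last exact: stack_frame_trans fr1 fr2.
by case: (f x) h2.
Qed.

(** Cyclic reduction of a reduced word: first and last letters are dropped while they are mutually
    inverse. *)
Definition trim j :=
  While (Band (Nlt (Nvar (bottom_of j)) (Nvar (top_of j)))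
          (Neq (Nget (stack_of j) (Nvar (bottom_of j)))
             (Nget (inverses_of j) (Nsub (Nvar (top_of j)) (Nconst 1)))))
    (Seq (Nset (bottom_of j) (Nconst 0) (Nadd (Nvar (bottom_of j)) (Nconst 1)))
         (Nset (top_of j) (Nconst 0) (Nsub (Nvar (top_of j)) (Nconst 1)))).

Lemma trim_spec j s w : stores s j 0 w -> reduced w ->
  ensures (trim j) s (fun s' => exists lo c, [/\ stores s' j lo c,
    conjugate flip c w, cycle (noninverse flip) c & stack_frame j s s']).
Proof.
move=> hw rw.
apply: (ensures_while (I := fun s' => exists lo c, [/\ stores s' j lo c,
    conjugate flip c w, reduced c & stack_frame j s s'])
  (m := fun s' => (nmem s' (top_of j) 0 - nmem s' (bottom_of j) 0)%N)).
- by exists 0%N, w; split=> //; exact: conjugate_refl.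
- move=> s1 [lo [c [[hb ht hV hW] cw rc fr]]].
  rewrite -[beval _ _]/(beval s1 (Nlt _ _) && beval s1 (Neq _ _)).
  rewrite Nlt_eval Neq_eval /= hb ht -{1}[lo]addn0 ltn_add2l.
  case: c ht hV hW cw rc => // x c; case/lastP: c => [|c y].
    (* A single letter is not its own inverse, so the test fails and the bounds never pass one
       another. *)
    move=> ht hV hW _ _ /=; rewrite addnK.
    have := hV 0%N 0%N isT; have := hW 0%N 0%N isT; rewrite addn0 => -> -> /=.
    by rewrite (inj_eq code_inj) eq_sym (negbTE (flip_neq x)).
  move=> ht hV hW cw rc; rewrite /= size_rcons addnS subn1 /=.
  have := hV 0%N 0%N isT; rewrite addn0 => -> /=.
  have := hW (size c).+1 0%N; rewrite /= size_map size_rcons => /(_ (ltnSn _)) ->.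
  rewrite map_rcons nth_rcons size_map ltnn eqxx (inj_eq code_inj) => /eqP ex.
  apply: ensures_seq; apply: ensures_nset; apply: ensures_nset.
  split; last first.
    by case: (j) hb ht => /= hb ht; rewrite /update /= hb ht size_rcons; lia.
  exists lo.+1, c; split; [split|..].
  + by case: (j) hb => /= hb; rewrite /update /= hb addn1.
  + by case: (j) ht => /= ht; rewrite /update /= ht size_rcons /=; lia.
  + apply: (@holds_eq _ (nmem s1 (stack_of j))); first by case: (j).
    apply: holds_prefix (_ : holds _ _ (map code c ++ map code [:: y])).
    by rewrite -map_cat cats1; exact: holds_behead hV.
  + apply: (@holds_eq _ (nmem s1 (inverses_of j))); first by case: (j).
    apply: holds_prefix (_ : holds _ _ (_ c ++ map (code \o flip) [:: y])).
    by rewrite -map_cat cats1; exact: holds_behead hW.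
  + apply: conjugate_trans cw; apply: conjugate_sym.
    apply: conjugate_trans (conjugate_cancel flip y c).
    rewrite -rcons_cons -ex -cats1 -cat1s; exact: (conjugate_cat _ _ [:: y]).
  + by move: rc; rewrite /= rcons_path => /andP[/path_sorted].
  + apply: stack_frame_trans fr _; split=> // a i /=.
    by rewrite !inE !negb_or => /and4P[_ _ h3 h4]; rewrite !update_array.
move=> s1 [lo [c [[hb ht hV hW] cw rc fr]]] hnot; exists lo, c; split=> //.
(* On exit the word is empty or its ends are not mutually inverse, which is the wrap-around
   condition of [cycle]. *)
move: hnot; rewrite -[beval _ _]/(beval s1 (Nlt _ _) && beval s1 (Neq _ _)).
rewrite Nlt_eval Neq_eval /= hb ht -{1}[lo]addn0 ltn_add2l.
case: c ht hV hW cw rc => // x c ht hV hW _ /= rc.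
have := hV 0%N 0%N isT; rewrite addn0 => -> /=.
rewrite addnS subn1 /= (hW (size c) 0%N) /= ?size_map //.
rewrite -[_ :: _]/(map (code \o flip) (x :: c)) (nth_map x) //=.
rewrite -[nth x (x :: c) (size c)]last_nth (inj_eq code_inj) => xl.
by rewrite rcons_path rc.
Qed.

End StackPrograms.

(** * Reading the reduced word of a line *)

Section LinePrograms.
Variable R : realType.
Implicit Types (s : state R) (j : bool) (w : seq (bool * nat)) (t : seq nat).

Definition puncture_exp i := (Rget 0 (Nconst i), Rget 1 (Nconst i)).

Definition start_exp j :=
  (Rget (xs_of j) (Nvar (index_of j)), Rget (ys_of j) (Nvar (index_of j))).

Definition end_exp j :=
  (Rget (xs_of j) (Nadd (Nvar (index_of j)) (Nconst 1)),
   Rget (ys_of j) (Nadd (Nvar (index_of j)) (Nconst 1))).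

Definition edge_test j (x : bool * nat) :=
  if x.1 then Bcrosses (start_exp j) (end_exp j) (puncture_exp x.2)
  else Bcrosses (end_exp j) (start_exp j) (puncture_exp x.2).

Definition edge_program j t :=
  push_all j (edge_test j) ([seq (true, i) | i <- t] ++ [seq (false, i) | i <- rev t]).

Lemma edge_program_spec j t (q : nat -> plane R) s w : stores s j 0 w ->
  (forall i, i \in t -> point_eval s (puncture_exp i) = q i) ->
  ensures (edge_program j t) s (fun s' =>
    stores s' j 0 (foldl stack_push w
      (edge_word q t (point_eval s (start_exp j)) (point_eval s (end_exp j)))) /\
    stack_frame j s s').
Proof.
move=> hw hq; set A := point_eval s (start_exp j); set B := point_eval s _.
pose f (x : bool * nat) := if x.1 then crosses A B (q x.2) else crosses B A (q x.2).
have -> : edge_word q t A B =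
    filter f ([seq (true, i) | i <- t] ++ [seq (false, i) | i <- rev t]).
  by rewrite filter_cat !filter_map.
apply: push_all_spec => // x s' xt [er en].
have xt' : x.2 \in t.
  by move: xt; rewrite mem_cat => /orP[] /mapP[i it ->] //; rewrite -mem_rev.
have eA : point_eval s' (start_exp j) = A.
  by rewrite /A /point_eval /= er !en //; case: (j).
have eB : point_eval s' (end_exp j) = B.
  by rewrite /B /point_eval /= er !en //; case: (j).
have eq : point_eval s' (puncture_exp x.2) = q x.2.
  by rewrite -hq // /point_eval /= er.
by rewrite /edge_test /f; case: ifP => _; rewrite Bcrosses_eval eA eB eq.
Qed.

(** The first vertex is copied behind the last one, so that the closing edge is read like the
    others. *)
Definition line_program j t :=
  Seq (Rset (xs_of j) (length_of j) (Rget (xs_of j) (Nconst 0)))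
  (Seq (Rset (ys_of j) (length_of j) (Rget (ys_of j) (Nconst 0)))
  (Seq (While (Nlt (Nvar (index_of j)) (length_of j))
    (Seq (edge_program j t)
       (Nset (index_of j) (Nconst 0) (Nadd (Nvar (index_of j)) (Nconst 1)))))
  (trim j))).

Definition line_frame j s s' :=
  (forall a i, a \notin [:: stack_of j; inverses_of j; top_of j; bottom_of j;
     index_of j] -> nmem s' a i = nmem s a i) /\
  (forall a i, a \notin [:: xs_of j; ys_of j] -> rmem s' a i = rmem s a i).

Lemma line_program_spec j t (q : nat -> plane R) s (l : seq (plane R)) :
  l != [::] ->
  (forall i, i \in t -> point_eval s (puncture_exp i) = q i) ->
  (forall i, (i < size l)%N ->
     (rmem s (xs_of j) i, rmem s (ys_of j) i) = nth 0 l i) ->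
  neval s (length_of j) = size l ->
  nmem s (top_of j) 0 = 0%N -> nmem s (bottom_of j) 0 = 0%N ->
  nmem s (index_of j) 0 = 0%N ->
  ensures (line_program j t) s (fun s' => line_frame j s s' /\
    exists lo c, [/\ stores s' j lo c, conjugate flip c (line_word q t l) &
      cycle (noninverse flip) c]).
Proof.
case: l => // A u _ hq hl hsize ht hb hi.
set l := A :: u in hl hsize; pose r := rcons u A.
have size_r : size r = size l by rewrite size_rcons.
apply: ensures_seq; apply: ensures_rset.
apply: ensures_seq; apply: ensures_rset; set s1 := State _ _.
have es1 : s1 = State (nmem s)
    (update (update (rmem s) (xs_of j) (size l) A.1) (ys_of j) (size l) A.2).
  have e0 := hl 0%N isT; have ex := congr1 fst e0; have ey := congr1 snd e0.
  rewrite /s1; case: (j) ex ey hsize => /= -> <- ->; by rewrite update_array.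
have fr1 : line_frame j s s1.
  split=> [|a i]; first by rewrite es1.
  by rewrite !inE negb_or => /andP[h1 h2]; rewrite es1 /= !update_array.
have hl1 i : (i <= size l)%N ->
    (rmem s1 (xs_of j) i, rmem s1 (ys_of j) i) = nth 0 (A :: r) i.
  have -> : A :: r = rcons l A by [].
  rewrite nth_rcons leq_eqVlt es1 => /orP[/eqP->|lt].
    by rewrite ltnn eqxx; case: (A) => x y; case: (j); rewrite /update /= eqxx.
  rewrite lt -hl //; move: lt; rewrite ltn_neqAle => /andP[ne _].
  by rewrite /= !update_cell.
have hq1 i : i \in t -> point_eval s1 (puncture_exp i) = q i.
  by move=> it; rewrite -hq // es1 /point_eval /=; case: (j).
(* After [i] edges the stack holds a reduced word equal in the free group to the word of those
   edges. *)
pose inv s' := exists i w, [/\ (i <= size l)%N, nmem s' (index_of j) 0 = i,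
  stores s' j 0 w, reduced w & free_eq flip w (path_word q t A (take i r))] /\
  line_frame j s s' /\ rmem s' = rmem s1.
apply: ensures_seq; apply: (@ensures_imp _ _ _ (fun s' => exists w,
    [/\ stores s' j 0 w, reduced w, conjugate flip w (line_word q t l) &
        line_frame j s s'])); last first.
  move=> s2 [w [hw rw cw fr2]]; apply: ensures_imp (trim_spec hw rw) _.
  move=> s3 [lo [c [hc cc ic fr3]]]; split.
    split=> a i ha; last by rewrite fr3.1 fr2.2.
    rewrite fr3.2 ?fr2.1 //; apply: contra ha.
    by rewrite !inE => /or4P[] ->; rewrite ?orbT.
  by exists lo, c; split=> //; exact: conjugate_trans cc cw.
apply: (ensures_while (I := inv)
  (m := fun s' => (size l - nmem s' (index_of j) 0)%N)).
- exists 0%N, [::]; split=> //; rewrite es1; split=> //.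
  by rewrite take0; exact: free_eq_refl.
- move=> s2 [i [w [[il ei hw rw fw] [fr2 er2]]]]; rewrite Nlt_eval.
  have len2 : neval s2 (length_of j) = size l.
    by rewrite -hsize /= fr2.1 //; case: (j).
  rewrite len2 /= ei => lt_il; apply: ensures_seq.
  have hq2 k : k \in t -> point_eval s2 (puncture_exp k) = q k.
    by move=> kt; rewrite -hq1 // /point_eval /= er2.
  apply: ensures_imp (edge_program_spec hw hq2) _ => s3 [hw3 fr3].
  apply: ensures_nset.
  have eA : point_eval s2 (start_exp j) = last A (take i r).
    rewrite /point_eval /= er2 ei hl1 ?(ltnW lt_il) // -[take _ _]/(_ _ _).
    by rewrite (last_nth 0) size_take size_r lt_il; case: (i) lt_il => //= k kl;
      rewrite nth_take.
  have eB : point_eval s2 (end_exp j) = nth 0 r i.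
    by rewrite /point_eval /= er2 ei addn1 hl1.
  rewrite eA eB in hw3.
  have ei3 : nmem s3 (index_of j) 0 = i by rewrite fr3.2 //; case: (j).
  split; last by move: lt_il; case: (j) ei3; rewrite /update /= => ->; lia.
  have [rw3 fw3] := foldl_stack_push
    (edge_word q t (last A (take i r)) (nth 0 r i)) rw.
  exists i.+1, (foldl stack_push w (edge_word q t (last A (take i r)) (nth 0 r i))).
  split; last split.
  + split=> //.
    * by case: (j) ei3; rewrite /update /= => ->; rewrite addn1.
    * by case: hw3; case: (j) => *; split.
    * apply: free_eq_trans fw3 _.
      rewrite (take_nth 0) ?size_r // -cats1 path_word_cat.
      apply: free_eq_cat => //; rewrite /path_word /= cats0; exact: free_eq_refl.
  + split=> a k ha; last by rewrite /= fr3.1 fr2.2.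
    have := ha; rewrite !inE !negb_or => /and5P[h1 h2 h3 h4 h5].
    rewrite /= update_array // fr3.2 ?fr2.1 // !inE !negb_or h1 h2 h3.
    exact: h4.
  + by rewrite /= fr3.1.
move=> s2 [i [w [[il ei hw rw fw] [fr2 er2]]]]; rewrite Nlt_eval.
have len2 : neval s2 (length_of j) = size l.
  by rewrite -hsize /= fr2.1 //; case: (j).
rewrite len2 /= ei -leqNgt => li; exists w; split=> //.
apply: free_eq_conjugate; move: fw.
by rewrite take_oversize ?size_r.
Qed.

End LinePrograms.

(** * Comparison of cyclic words *)

Lemma rotS1 (T : Type) k (w : seq T) : (k <= size w)%N -> iter k (rot 1) w = rot k w.
Proof.
elim: k => [|k IHk] lt; first by rewrite rot0.
by rewrite iterS IHk ?(ltnW lt) // -rotD.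
Qed.

(** The bound admits [k = size w], so that the empty word too gets one trial. *)
Lemma same_cyclic_iter (T : Type) (u w : seq T) :
  same_cyclic w u <-> exists2 k, (k < (size w).+1)%N & u = iter k (rot 1) w.
Proof.
by rewrite same_cyclic_bounded; split=> -[k kw ->]; exists k; rewrite ?rotS1.
Qed.

Lemma same_cyclic_map_inj (T T' : Type) (f : T -> T') (u w : seq T) :
  injective f -> same_cyclic (map f u) (map f w) <-> same_cyclic u w.
Proof.
move=> fI; split=> -[k e]; exists k; last by rewrite e map_rot.
by move: e; rewrite -map_rot => /(inj_map fI).
Qed.

Section Comparison.
Variable R : realType.
Implicit Types (s : state R) (u w : seq nat).

Definition shift_cell := 11%N.
Definition offset_cell := 12%N.

Definition window s j lo w := [/\ nmem s (bottom_of j) 0 = lo,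
  nmem s (top_of j) 0 = (lo + size w)%N & holds (nmem s (stack_of j)) lo w].

Definition window_length j := Nsub (Nvar (top_of j)) (Nvar (bottom_of j)).

(** The answer cell is set on success and never cleared, so repeated comparisons accumulate a
    disjunction. *)
Definition compare_windows :=
  Seq (Nset offset_cell (Nconst 0) (Nconst 0))
  (Seq (While (Band (Nlt (Nvar offset_cell) (window_length false))
     (Neq (Nget (stack_of false) (Nadd (Nvar (bottom_of false)) (Nvar offset_cell)))
          (Nget (stack_of true) (Nadd (Nvar (bottom_of true)) (Nvar offset_cell)))))
     (Nset offset_cell (Nconst 0) (Nadd (Nvar offset_cell) (Nconst 1))))
   (If (Nle (window_length false) (Nvar offset_cell))
      (Nset 0 (Nconst 0) (Nconst 1)) Skip)).

Lemma compare_windows_spec s lo lo' u w :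
  window s false lo u -> window s true lo' w -> size u = size w ->
  ensures compare_windows s (fun s' => [/\ window s' false lo u,
    window s' true lo' w, nmem s' shift_cell 0 = nmem s shift_cell 0 &
    nmem s' 0 0 = if u == w then 1%N else nmem s 0 0]).
Proof.
move=> hu hw uw; apply: ensures_seq; apply: ensures_nset; apply: ensures_seq.
pose inv s' := [/\ window s' false lo u, window s' true lo' w,
  nmem s' shift_cell 0 = nmem s shift_cell 0, nmem s' 0 0 = nmem s 0 0 &
  (nmem s' offset_cell 0 <= size u)%N /\
  take (nmem s' offset_cell 0) u = take (nmem s' offset_cell 0) w].
apply: (ensures_while (I := inv)
  (m := fun s' => (size u - nmem s' offset_cell 0)%N)).
- split=> //; rewrite /= /update /= ?take0 //.
- move=> s1 [[hb ht hV] [hb' ht' hV'] es e0 [ju eu]].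
  rewrite -[beval _ _]/(beval s1 (Nlt _ _) && beval s1 (Neq _ _)).
  rewrite Nlt_eval Neq_eval /= -/offset_cell hb ht hb' addKn.
  move: ju eu; set k := nmem s1 offset_cell 0 => ju eu /andP[ku].
  rewrite (hV k 0%N) // (hV' k 0%N) -?uw // => /eqP ek.
  apply: ensures_nset; split; last by rewrite /update /= -/k addn1; lia.
  split=> //; rewrite /update /= -/k addn1; split=> //.
  by rewrite !(take_nth 0%N) -?uw // eu ek.
move=> s1 [[hb ht hV] [hb' ht' hV'] es e0 [ju eu]].
rewrite -[beval _ _]/(beval s1 (Nlt _ _) && beval s1 (Neq _ _)).
rewrite Nlt_eval Neq_eval /= -/offset_cell hb ht hb' addKn => stop.
apply: ensures_if; rewrite /= -/offset_cell hb ht addKn => hk.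
  apply: ensures_nset; split=> //; rewrite /update /=.
  have -> : u = w; last by rewrite eqxx.
  by move: eu; rewrite !take_oversize -?uw.
apply: ensures_skip; split=> //; rewrite e0; case: eqP => // e.
move: stop hk; rewrite -ltnNge => + lt; rewrite lt /=.
by rewrite (hV _ 0%N) // (hV' _ 0%N) -?uw // e eqxx.
Qed.

(* Copying its first letter behind its last one and moving both bounds rotates
   the word in place. *)
Definition shift_window :=
  Seq (Nset (stack_of true) (Nvar (top_of true)) (Nget (stack_of true) (Nvar (bottom_of true))))
  (Seq (Nset (bottom_of true) (Nconst 0) (Nadd (Nvar (bottom_of true)) (Nconst 1)))
  (Seq (Nset (top_of true) (Nconst 0) (Nadd (Nvar (top_of true)) (Nconst 1)))
       (Nset shift_cell (Nconst 0) (Nadd (Nvar shift_cell) (Nconst 1))))).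

Lemma shift_window_spec s lo lo' u w :
  window s false lo u -> window s true lo' w ->
  ensures shift_window s (fun s' => [/\ window s' false lo u,
    window s' true lo'.+1 (rot 1 w),
    nmem s' shift_cell 0 = (nmem s shift_cell 0).+1 &
    nmem s' 0 0 = nmem s 0 0]).
Proof.
move=> [hb ht hV] [hb' ht' hV']; apply: ensures_seq; apply: ensures_nset.
apply: ensures_seq; apply: ensures_nset; apply: ensures_seq; apply: ensures_nset.
apply: ensures_nset; rewrite /= in hb ht hV hb' ht' hV'.
split; rewrite ?/window /update /= ?addn1 //; rewrite hb' ht'; split=> //.
  by rewrite size_rot.
case: w ht' hV' => [|x w] ht' hV'; first by move=> k x0.
rewrite rot1_cons; have e : (lo' + size (x :: w) = lo'.+1 + size w)%N.
  by rewrite /= addnS.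
apply: (holds_rcons (holds_behead hV')) => [i|].
  by rewrite e => /negbTE->.
by rewrite e eqxx -[lo' in LHS]addn0 (hV' 0%N 0%N).
Qed.

(** The answer cell is reset first because the input stores the number of punctures there. *)
Definition compare_program :=
  Seq (Nset 0 (Nconst 0) (Nconst 0))
  (If (Neq (window_length false) (window_length true))
    (While (Nle (Nvar shift_cell) (window_length false))
       (Seq compare_windows shift_window))
    Skip).

Lemma compare_program_spec s lo lo' u w :
  window s false lo u -> window s true lo' w -> nmem s shift_cell 0 = 0%N ->
  ensures compare_program s (fun s' => nmem s' 0 0 <> 0%N <-> same_cyclic w u).
Proof.
move=> hu hw hs; apply: ensures_seq; apply: ensures_nset; set s1 := State _ _.
have hu1 : window s1 false lo u by case: hu.
have hw1 : window s1 true lo' w by case: hw.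
apply: ensures_if; rewrite Neq_eval; last first.
  case: hu1 => /= -> -> _; case: hw1 => /= -> -> _; rewrite !addKn => ne.
  apply: ensures_skip; split=> //= /same_cyclic_size e.
  by rewrite e eqxx in ne.
move=> e; have {e} uw : size u = size w.
  by move: e; case: hu1 => /= -> -> _; case: hw1 => /= -> -> _; rewrite !addKn => /eqP.
(* After [r] trials the second window has moved up [r] cells, and the answer tells whether one of
   the first [r] rotations matched. *)
pose inv s' := exists r, [/\ (r <= (size w).+1)%N, nmem s' shift_cell 0 = r,
  window s' false lo u, window s' true (lo' + r) (iter r (rot 1) w) &
  nmem s' 0 0 <> 0%N <-> exists2 k, (k < r)%N & u = iter k (rot 1) w].
apply: (ensures_while (I := inv)
  (m := fun s' => ((size w).+1 - nmem s' shift_cell 0)%N)).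
- exists 0%N; rewrite addn0; split=> //.
  by split=> [[]|[k]].
- move=> s2 [r [rw er hu2 hw2 found]] /=; rewrite er.
  case: (hu2) => -> -> _; rewrite addKn uw => lt_r.
  have size_r k : size (iter k (rot 1) w) = size w.
    by elim: k => //= k IHk; rewrite size_rot.
  apply: ensures_seq; apply: ensures_imp (compare_windows_spec hu2 hw2 _) _.
    by rewrite size_r.
  move=> s3 [hu3 hw3 er3 e3].
  apply: ensures_imp (shift_window_spec hu3 hw3) _ => s4 [hu4 hw4 er4 e4].
  rewrite er4 er3 er; split; last by lia.
  exists r.+1; split=> //; [by rewrite er4 er3 er | by rewrite addnS iterS |].
  rewrite e4 e3; case: eqP => eu; split=> //.
  + by move=> _; exists r.
  + by move=> /found[k kr ->]; exists k => //; exact: ltnW.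
  + case=> k; rewrite ltnS leq_eqVlt => /orP[/eqP->|kr] ek; first by case: eu.
    by apply/found; exists k.
move=> s2 [r [rw er hu2 _ found]] /=; rewrite er.
case: hu2 => -> -> _; rewrite addKn uw -ltnNge => lt_r.
have er' : r = (size w).+1 by apply/eqP; rewrite eqn_leq rw.
by rewrite found er' same_cyclic_iter.
Qed.

End Comparison.

(** * The complete decision program *)

Section MainProgram.
Variables (R : realType) (p l l' : seq (plane R)).
Local Notation q := (nth 0 p).

Fixpoint sorted_test (t : seq nat) : bexp :=
  match t with
  | i :: (j :: _) as t' =>
    Band (Blexlt (puncture_exp i) (puncture_exp j)) (sorted_test t')
  | _ => Nle (Nconst 0) (Nconst 0)
  end.

Definition homotopy_program (t : seq nat) :=
  Seq (line_program false t) (Seq (line_program true t) compare_program).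

(* Rather than sorting the punctures, the program goes through all orders until
   it meets the lexicographic one. *)
Definition choose_order (ts : seq (seq nat)) :=
  foldr (fun t P => If (sorted_test t) (homotopy_program t) P) Skip ts.

Lemma sorted_test_eval t :
  beval (input p l l') (sorted_test t) = sorted (fun i j => lexlt (q i) (q j)) t.
Proof.
have pe i : point_eval (input p l l') (puncture_exp i) = q i.
  by rewrite /point_eval /=; case: (nth _ p i).
elim: t => // i [//|j t] IHt.
by rewrite -[LHS]/(beval _ (Blexlt _ _) && beval _ (sorted_test (j :: t))) Blexlt_eval !pe IHt.
Qed.

Lemma homotopy_program_spec t : sorted (fun i j => lexlt (q i) (q j)) t ->
  closed_line_in (punctured q t) l -> closed_line_in (punctured q t) l' ->
  ensures (homotopy_program t) (input p l l') (fun s' =>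
    nmem s' 0 0 <> 0%N <-> homotopic (punctured q t) l l').
Proof.
move=> st cl cl'; apply: ensures_seq.
have l0 : l != [::] by case: cl => /eqP.
have l'0 : l' != [::] by case: cl' => /eqP.
have pe i : point_eval (input p l l') (puncture_exp i) = q i.
  by rewrite /point_eval /=; case: (nth _ p i).
apply: ensures_imp (@line_program_spec R false t q (input p l l') l l0 _ _ _ _ _ _) _ => //.
  by move=> i _ /=; case: (nth _ l i).
move=> s1 [[n1 r1] [lo [c [hc cc ic]]]]; apply: ensures_seq.
apply: ensures_imp (@line_program_spec R true t q s1 l' l'0 _ _ _ _ _ _) _.
- by move=> i _; rewrite -pe /point_eval /= !r1.
- by move=> i _ /=; rewrite !r1 //=; case: (nth _ l' i).
- by rewrite /= n1.
- by rewrite n1.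
- by rewrite n1.
- by rewrite n1.
move=> s2 [[n2 r2] [lo' [c' [hc' cc' ic']]]].
(* The second run works on its own arrays and leaves the first word intact. *)
have w1 : window s2 false lo (map code c).
  case: hc => b1 t1 v1 _; split; rewrite ?n2 ?size_map //.
  by move=> k x0 hk; rewrite n2 // (v1 k x0).
have w2 : window s2 true lo' (map code c').
  by case: hc' => b1 t1 v1 _; split; rewrite ?size_map.
apply: ensures_imp (compare_program_spec w1 w2 _) _; first by rewrite n2 // n1.
move=> s3 ->; rewrite (same_cyclic_map_inj _ _ code_inj) homotopic_conjugate //.
split=> [cc_|ll'].
  apply: conjugate_trans (conjugate_sym cc) _; apply: conjugate_trans cc'.
  exact/conjugate_sym/conjugate_same_cyclic.
apply: (conjugate_irreducible flipK flip_neq) => //.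
apply: conjugate_trans cc' _; apply: conjugate_trans (conjugate_sym ll') _.
exact: conjugate_sym.
Qed.

End MainProgram.

Theorem theorem1p7 (R : realType) (n : nat) :
  exists P : program, recognizes_homotopy R n P.
Proof.
exists (choose_order (permutations (iota 0 n))) => p p_uniq l l' cl cl'.
pose q := nth 0 p; pose lt i j := lexlt (q i) (q j).
have perm_punctured t : perm_eq t (iota 0 n) -> plane_minus p = punctured q t.
  move=> t_perm; apply/funext => X; apply/propext; split=> [Xp i|Xq].
    rewrite (perm_mem t_perm) mem_iota => /= i_n eX.
    by move/negP: Xp; apply; rewrite eX mem_nth // size_tuple.
  apply/negP => /(nthP 0)[i]; rewrite size_tuple => i_n eX.
  by apply: (Xq i); rewrite // (perm_mem t_perm) mem_iota.
have [t t_perm t_sorted] : exists2 t, t \in permutations (iota 0 n) & sorted lt t.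
  (* Comparing points rather than indices makes this total on all naturals, including those beyond
     [n] where [q] takes a default value. Strictness below [n] comes from the distinctness of the
     punctures. *)
  pose le i j := (q i == q j) || lt i j.
  have le_total : total le.
    move=> i j; rewrite /le /lt eq_sym.
    by case: (lexlt_total (q i) (q j)) => [->|->|->]; rewrite ?eqxx ?orbT.
  have le_trans : transitive le.
    move=> j i k; rewrite /le /lt => /orP[/eqP->//|ij] /orP[/eqP<-|jk].
      by rewrite ij orbT.
    by rewrite (lexlt_trans ij jk) orbT.
  have sort_perm : perm_eq (sort le (iota 0 n)) (iota 0 n) by rewrite perm_sort.
  exists (sort le (iota 0 n)); first by rewrite mem_permutations.
  have : sorted [rel i j | le i j && (i != j)] (sort le (iota 0 n)).
    apply: pairwise_sorted; rewrite pairwise_relI -uniq_pairwise sort_uniq iota_uniq.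
    by rewrite andbT -sorted_pairwise // sort_sorted.
  apply: (@sub_in_sorted _ (fun i => (i < n)%N)); last first.
    by apply/allP => i; rewrite mem_sort mem_iota.
  move=> i j; rewrite !unfold_in => i_n j_n /andP[/orP[|//]].
  by rewrite nth_uniq ?size_tuple // => ->.
have : exists2 t, t \in permutations (iota 0 n) & sorted lt t by exists t.
have : forall t, t \in permutations (iota 0 n) -> perm_eq t (iota 0 n).
  by move=> u; rewrite mem_permutations.
(* Whichever candidate first passes the test is a correct order, and one that passes remains among
   the candidates left. *)
rewrite /answers; elim: (permutations _) => [|u ts IHts] hts; first by case.
move=> ex; rewrite /=.
suff [s' e a] : ensures (choose_order (u :: ts)) (input p l l')
  (fun s' => nmem s' 0 0 <> 0%N <-> homotopic (plane_minus p) l l') by exists s'.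
have hu := perm_punctured u (hts u (mem_head _ _)).
apply: ensures_if; rewrite sorted_test_eval => hu_sorted.
  rewrite hu in cl cl' *.
  exact: homotopy_program_spec.
case: IHts => [v vts||s' [e a]]; last by exists s'.
  by apply: hts; rewrite inE vts orbT.
case: ex => v; rewrite inE => /orP[/eqP->|vts] hv; last by exists v.
by rewrite hv in hu_sorted.
Qed.
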